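(* Let $B\subset\mathcal H$ be bounded. Suppose that for all sufficiently small $\varepsilon>0$ there is a set $V_\varepsilon\subset P_\varepsilon\mathcal H$, and that there is $\sigma>0$ independent of sufficiently small $\varepsilon$, such that $$\bigl\langle A(p_1-p_2)-P_\varepsilon\bigl(F(p_1+h_\varepsilon(p_1))-F(p_2+h_\varepsilon(p_2))\bigr),\,p_1-p_2\bigr\rangle_{\mathcal H}\ge\sigma\|p_1-p_2\|_{\mathcal H}^2\qquad\text{for all }p_1,p_2\in V_\varepsilon .$$ Suppose further that there is $t_*\ge0$, independent of sufficiently small $\varepsilon$, such that $$P_\varepsilon S(t)u_0\in V_\varepsilon\quad\text{and}\quad\Phi_\varepsilon(t)P_\varepsilon u_0\in V_\varepsilon\qquad\text{for all }u_0\in B,\ t\ge t_* .$$ Then there is a constant $C_B$ such that, for all sufficiently small $\varepsilon>0$, $$\sup_{u_0\in B}\ \sup_{t\ge0}\|R_\varepsilon S(t)u_0-S_\varepsilon^{\mathcal M}(t)R_\varepsilon u_0\|_{\mathcal H}\le C_B\,\varepsilon^2.$$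
   Context: $\mathcal H$ is an infinite-dimensional real Hilbert space and $A:\mathrm D(A)\subset\mathcal H\to\mathcal H$ is a nonnegative self-adjoint operator with compact resolvent. The map $F:\mathcal H\to\mathcal H$ satisfies, for constants $M,L>0$, $\|F(u)\|_{\mathcal H}\le M$ and $\|F(u)-F(w)\|_{\mathcal H}\le L\|u-w\|_{\mathcal H}$ for all $u,w\in\mathcal H$. Fix $\mu>0$. For $0<\varepsilon\le1$ let $\Lambda_\varepsilon=\mu\varepsilon^{-2}$, $P_\varepsilon=\mathbf 1_{[0,\Lambda_\varepsilon]}(A)$, $Q_\varepsilon=I-P_\varepsilon$, $A_\varepsilon=A+\varepsilon^{-1}Q_\varepsilon$ with $\mathrm D(A_\varepsilon)=\mathrm D(A)$. Put $\beta_\varepsilon=\sup\sigma(A|_{P_\varepsilon\mathcal H})$ ($=0$ if $P_\varepsilon\mathcal H=\{0\}$), $\lambda_\varepsilon^+=\inf\sigma(A|_{Q_\varepsilon\mathcal H})$, $\alpha_\varepsilon=\lambda_\varepsilon^++\varepsilon^{-1}$, $\gamma_\varepsilon=\alpha_\varepsilon-\beta_\varepsilon\ge\varepsilon^{-1}$. $S(t)$ and $S_\varepsilon(t)$ are the semiflows on $\mathcal H$ of global mild solutions of $\dot v+Av=F(v)$ and $\dot v^\varepsilon+A_\varepsilon v^\varepsilon=F(v^\varepsilon)$, respectively. Throughout $\varepsilon$ is such that $\gamma_\varepsilon\ge8L$ (true for all small $\varepsilon$); then $\mathcal M_\varepsilon=\{p+h_\varepsilon(p):p\in P_\varepsilon\mathcal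 H\}$ denotes the inertial manifold of $S_\varepsilon(t)$ given by classical theory, with $h_\varepsilon:P_\varepsilon\mathcal H\to Q_\varepsilon\mathcal H$, $\|h_\varepsilon\|_{L^\infty}\le M/\alpha_\varepsilon$, $\operatorname{Lip}(h_\varepsilon)\le4L/\gamma_\varepsilon$, $S_\varepsilon(t)\mathcal M_\varepsilon=\mathcal M_\varepsilon$ for $t\ge0$. $\Phi_\varepsilon(t)$ is the flow on $P_\varepsilon\mathcal H$ of the reduced equation $\dot p+Ap=P_\varepsilon F(p+h_\varepsilon(p))$, which governs the dynamics on $\mathcal M_\varepsilon$: $S_\varepsilon(t)(p+h_\varepsilon(p))=\Phi_\varepsilon(t)p+h_\varepsilon(\Phi_\varepsilon(t)p)$. Write $S_\varepsilon^{\mathcal M}(t)=S_\varepsilon(t)|_{\mathcal M_\varepsilon}$ and define $R_\varepsilon:\mathcal H\to\mathcal M_\varepsilon$, $R_\varepsilon u=P_\varepsilon u+h_\varepsilon(P_\varepsilon u)$. *)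

(* Defs.v *)
From HB Require Import structures.
From mathcomp Require Import all_boot all_order all_algebra sesquilinear.
From mathcomp Require Import all_classical all_reals all_analysis.

Set Implicit Arguments.
Unset Strict Implicit.
Unset Printing Implicit Defensive.

Import Order.TTheory GRing.Theory Num.Theory.
Import numFieldNormedType.Exports.

Local Open Scope classical_set_scope.
Local Open Scope ring_scope.

(* A real Hilbert space is a complete normed module [H] over [R : realType]
   together with [ip : {dot H for idfun}] (a symmetric positive definite
   bilinear form) that induces the norm of [H]. *)
Definition induces_norm (R : realType) (H : completeNormedModType R)
    (ip : {dot H for idfun}) : Prop :=
  forall u : H, `|u| ^+ 2 = ip u u.

Definition infinite_dimensional (R : realType) (H : completeNormedModType R) :
    Prop :=
  ~ exists (n : nat) (e : 'I_n -> H),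
      forall u, exists c : 'I_n -> R, u = \sum_(i < n) c i *: e i.

(* A possibly unbounded operator; values of [op] outside [dom] are junk. *)
Record partial_op (R : realType) (H : completeNormedModType R) := PartialOp {
  dom : set H ;
  op :> H -> H }.

Definition linear_op (R : realType) (H : completeNormedModType R)
    (A : partial_op H) : Prop :=
  forall (a : R) (u v : H), dom A u -> dom A v ->
    dom A (a *: u + v) /\ A (a *: u + v) = a *: A u + A v.

(* [A] is densely defined and its graph is that of its adjoint. *)
Definition self_adjoint (R : realType) (H : completeNormedModType R)
    (ip : {dot H for idfun}) (A : partial_op H) : Prop :=
  [/\ linear_op A,
      dense (dom A) &
      forall u w : H,
        (forall v, dom A v -> ip (A v) u = ip v w) <-> (dom A u /\ A u = w)].

Definition nonnegative_op (R : realType) (H : completeNormedModType R)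
    (ip : {dot H for idfun}) (A : partial_op H) : Prop :=
  forall u : H, dom A u -> 0 <= ip (A u) u.

(* [K] is the bounded inverse of [A - lam] regarded as an operator in the
   closed subspace [V], with domain [dom A `&` V]. *)
Definition resolvent_at (R : realType) (H : completeNormedModType R)
    (V : set H) (A : partial_op H) (lam : R) (K : H -> H) : Prop :=
  [/\ forall u, V u ->
        [/\ dom A (K u), V (K u) & A (K u) - lam *: K u = u],
      forall v, dom A v -> V v ->
        V (A v - lam *: v) /\ K (A v - lam *: v) = v &
      exists C : R, forall u, V u -> `|K u| <= C * `|u|].

Definition spectrum_on (R : realType) (H : completeNormedModType R)
    (V : set H) (A : partial_op H) : set R :=
  [set lam | ~ exists K, resolvent_at V A lam K].

Definition compact_resolvent (R : realType) (H : completeNormedModType R)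
    (A : partial_op H) : Prop :=
  exists (lam : R) (K : H -> H),
    resolvent_at setT A lam K /\
    forall U : set H, bounded_set U -> precompact (K @` U).

(* [E] is the projection-valued spectral measure of [A], so that the indicator
   function of a Borel set [X] in the functional calculus is [E X].  The
   condition [A = \int x dE(x)] is expressed by the finite scalar measures
   [X |-> <E X u, u>]: the domain consists of the [u] having a finite second
   moment, and by polarization the quadratic form determines [A]. *)
Definition is_spectral_measure (R : realType) (H : completeNormedModType R)
    (ip : {dot H for idfun}) (A : partial_op H) (E : set R -> H -> H) : Prop :=
  [/\ forall X, measurable X ->
        linear (E X) /\ (forall u v, ip (E X u) v = ip u (E X v)),
      forall X Y, measurable X -> measurable Y ->
        forall u, E (X `&` Y) u = E X (E Y u),
      forall u, E setT u = u &
      forall u, exists nu : {measure set (measurableTypeR R) -> \bar R},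
        [/\ forall X, measurable X -> nu X = (ip (E X u) u)%:E,
            dom A u <-> (\int[nu]_x (x ^+ 2)%:E < +oo)%E &
            dom A u -> (ip (A u) u)%:E = (\int[nu]_x x%:E)%E]].

(* [T t = exp (- t A)] for [t >= 0]: the strongly continuous semigroup of
   bounded operators whose generator is exactly [- A]. *)
Definition is_semigroup_of (R : realType) (H : completeNormedModType R)
    (A : partial_op H) (T : R -> H -> H) : Prop :=
  [/\ forall t, 0 <= t -> linear (T t) /\ continuous (T t),
      forall u, T 0 u = u,
      forall s t, 0 <= s -> 0 <= t -> forall u, T (s + t) u = T s (T t u),
      forall u, T t u @[t --> 0^'+] --> u &
      forall u w, (dom A u /\ A u = w) <->
        (t^-1 *: (u - T t u) @[t --> 0^'+] --> w)].

(* [I] is the integral over [`[a, b]] of the [H]-valued function [f]. The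
   library integrates scalar functions only, hence the pairing with vectors
   of [H]; for continuous [f] this is the Riemann (and Bochner) integral. *)
Definition is_integral (R : realType) (H : completeNormedModType R)
    (ip : {dot H for idfun}) (a b : R) (f : R -> H) (I : H) : Prop :=
  forall w : H,
    (@lebesgue_measure R).-integrable `[a, b] (fun s => (ip (f s) w)%:E) /\
    ip I w = \int[@lebesgue_measure R]_(s in `[a, b]) ip (f s) w.

(* [t |-> S t u0] is the global mild solution of [v' + A v = F v] starting at
   [u0]; only the values of [S] at nonnegative times are meaningful. *)
Definition is_mild_semiflow (R : realType) (H : completeNormedModType R)
    (ip : {dot H for idfun}) (A : partial_op H) (F : H -> H)
    (S : R -> H -> H) : Prop :=
  exists2 T : R -> H -> H, is_semigroup_of A T &
    forall u0 : H,
      {within `[0, +oo[, continuous (fun t => S t u0)} /\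
      forall t, 0 <= t ->
        is_integral ip 0 t (fun s => T (t - s) (F (S s u0)))
          (S t u0 - T t u0).

Section SpectralSplitting.
Context (R : realType) (H : completeNormedModType R).
Implicit Types (A : partial_op H) (P F h : H -> H) (E : set R -> H -> H).

Definition Peps E (mu eps : R) : H -> H := E `[0, mu / eps ^+ 2]%classic.

Definition compl P : H -> H := fun u => u - P u.

Definition perturbed A P (eps : R) : partial_op H :=
  PartialOp (dom A) (fun u => A u + eps^-1 *: compl P u).

(* On the trivial subspace the spectrum is empty, and [sup set0 = 0]. *)
Definition beta A P : R := sup (spectrum_on (range P) A).

Definition lambda_plus A P : R := inf (spectrum_on (range (compl P)) A).

Definition alpha A P (eps : R) : R := lambda_plus A P + eps^-1.

Definition gap A P (eps : R) : R := alpha A P eps - beta A P.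

Definition graph_over P h : set H := [set p + h p | p in range P].

(* The graph of [h] is the inertial manifold of the semiflow [S] of
   [v' + (A + eps^-1 (1 - P)) v = F v], where [M] and [L] bound [F] and its
   Lipschitz constant. *)
Definition inertial_graph A P (eps M L : R) (S : R -> H -> H) h : Prop :=
  [/\ forall p, range P p -> range (compl P) (h p),
      forall p, range P p -> `|h p| <= M / alpha A P eps,
      forall p1 p2, range P p1 -> range P p2 ->
        `|h p1 - h p2| <= 4 * L / gap A P eps * `|p1 - p2| &
      forall t, 0 <= t -> S t @` graph_over P h = graph_over P h].

Definition is_reduced_flow A P F h (Phi : R -> H -> H) : Prop :=
  forall p, range P p ->
    Phi 0 p = p /\
    forall t : R, range P (Phi t p) /\
      is_derive t 1 (fun s => Phi s p)
        (- A (Phi t p) + P (F (Phi t p + h (Phi t p)))).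

Definition Rmap P h : H -> H := fun u => P u + h (P u).

End SpectralSplitting.

(* Main.v *)
Require Import Defs.
From HB Require Import structures.
From mathcomp Require Import all_boot all_order all_algebra sesquilinear.
From mathcomp Require Import all_classical all_reals all_analysis.
From mathcomp Require Import measurable_realfun ring lra.

Set Implicit Arguments.
Unset Strict Implicit.
Unset Printing Implicit Defensive.

Import Order.TTheory GRing.Theory Num.Theory.
Import numFieldNormedType.Exports.

Local Open Scope classical_set_scope.
Local Open Scope ring_scope.

(* Write [Lam = mu / eps^2], [P] for the spectral cutoff and [Q = 1 - P].  Both
   [p = P S(t)u0] and [q = P S_eps(t)(R_eps u0)] satisfy an ordinary differential
   equation driven by the bounded operator [A P]: [p' = - A p + P F(S(t)u0)] and
   [q' = - A q + P F(q + h q)]; the latter is the reduced equation, so [q] is the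
   orbit of [P u0] under [Phi].  The forcing terms differ by the distance of
   [S(t)u0] to the graph, which is at most [e^(- Lam t) |u0| + 2 M / Lam] because
   [A >= Lam] on the range of [Q] and [|h| <= M / alpha <= M / Lam].  A Gronwall
   argument for [|p - q|^2] gives [O(Lam^-2)] up to time [tstar + 1]: the initial
   layer [e^(- Lam t)] has integral [1 / Lam] and is absorbed by an AM-GM
   inequality weighted by [Lam].  Later the layer is below [1 / Lam] and the
   monotonicity hypothesis keeps the error of the same order for all times.

   The bounds [beta <= Lam <= lambda_plus] come from the coercivity of
   [A - lam] (closed range and self-adjointness give the resolvent); the spectrum
   on the range of [Q] has to be shown nonempty, since [inf set0 = 0]. *)

(** * Hilbert space geometry *)

(** [is_semigroup_of] supplies linearity, strong continuity and the generator; uniform bounds,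
    contraction, symmetry and commutation with the cutoffs are all derived from these. Likewise
    [is_spectral_measure] describes [A] through scalar measures and its quadratic form, so operator
    statements about the cutoff come from polarization and density.

    A mild solution need not be differentiable in [H]; its projection is, because [A P] has norm at
    most [Lam]. That bound blows up as [eps] tends to 0, so it serves only to justify
    differentiation; the energy estimates themselves use the sign of [A], the Lipschitz constant [L]
    and [sigma].

    The monotonicity hypothesis compares [F] at points of the graph only, and [S(t)u0] is off the
    graph; the graph point [p + h p] is therefore inserted between [S(t)u0] and [q + h q]. Both
    points in the conclusion lie on the graph, so their distance is at most [(1 + Lip h) |p - q|],
    with [Lip h <= 1/2] once the gap reaches [8 L]. The rate [eps^2] is [1 / Lam] up to the factor
    [mu]. *)

Section InnerProduct.
Context (R : realType) (H : completeNormedModType R) (ip : {dot H for idfun}).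
Hypothesis hip : induces_norm ip.
Implicit Types (u v w : H) (a : R).

Lemma ipC u v : ip u v = ip v u.
Proof. by have := hermitian_subproof u v (s := ip); rewrite expr0 mul1r. Qed.

Lemma ipDl u v w : ip (u + v) w = ip u w + ip v w.
Proof. exact: linearDl. Qed.

Lemma ipBl u v w : ip (u - v) w = ip u w - ip v w.
Proof. exact: linearBl. Qed.

Lemma ipNl u w : ip (- u) w = - ip u w.
Proof. exact: linearNl. Qed.

Lemma ipZl a u w : ip (a *: u) w = a * ip u w.
Proof. exact: linearZl_LR. Qed.

Lemma ip0l w : ip 0 w = 0.
Proof. exact: linear0l. Qed.

Lemma ipDr u v w : ip w (u + v) = ip w u + ip w v.
Proof. by rewrite ipC ipDl !(ipC w). Qed.

Lemma ipBr u v w : ip w (u - v) = ip w u - ip w v.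
Proof. by rewrite ipC ipBl !(ipC w). Qed.

Lemma ipNr u w : ip w (- u) = - ip w u.
Proof. by rewrite ipC ipNl ipC. Qed.

Lemma ipZr a u w : ip w (a *: u) = a * ip w u.
Proof. by rewrite ipC ipZl ipC. Qed.

Lemma ip0r w : ip w 0 = 0.
Proof. by rewrite ipC ip0l. Qed.

Definition ipE := (ipDl, ipDr, ipBl, ipBr, ipNl, ipNr, ipZl, ipZr, ip0l, ip0r).

Lemma ip_norm u : ip u u = `|u| ^+ 2.
Proof. by rewrite hip. Qed.

Lemma ip_ge0 u : 0 <= ip u u.
Proof. by rewrite ip_norm sqr_ge0. Qed.

Lemma cauchy_schwarz u v : `|ip u v| <= `|u| * `|v|.
Proof.
have [->|v0] := eqVneq v 0; first by rewrite ip0r !normr0 mulr0.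
have nv : 0 < `|v| by rewrite normr_gt0.
rewrite -(ler_pXn2r (n := 2)) ?nnegrE ?mulr_ge0// exprMn real_normK ?num_real//.
have := ip_ge0 (`|v| ^+ 2 *: u - ip u v *: v).
rewrite !ipE !(ipC v u) !ip_norm => h.
have : 0 <= `|v| ^+ 2 * (`|u| ^+ 2 * `|v| ^+ 2 - ip u v ^+ 2) by nra.
by rewrite pmulr_rge0 ?exprn_gt0// subr_ge0.
Qed.

Lemma ip_le u v : ip u v <= `|u| * `|v|.
Proof. exact: le_trans (ler_norm _) (cauchy_schwarz u v). Qed.

(** Besides separating points, this turns vector identities into scalar ones that [ring] or [field]
    can close; most of its uses below are of that kind. *)
Lemma ip_inj u v : (forall w, ip u w = ip v w) -> u = v.
Proof.
move=> e; apply/eqP; rewrite -subr_eq0 -normr_eq0 -sqrf_eq0 -ip_norm.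
by rewrite ipBl e subrr.
Qed.

(** Testing with [w = u] suffices. Integrals of [H]-valued functions are defined weakly, and this is
    how their norms are estimated. *)
Lemma norm_le_ip u (C : R) : 0 <= C -> (forall w, `|ip u w| <= C * `|w|) -> `|u| <= C.
Proof.
move=> C0 /(_ u); rewrite ip_norm ger0_norm ?sqr_ge0// expr2.
have [->|u0] := eqVneq u 0; first by rewrite normr0.
by rewrite ler_pM2r// normr_gt0.
Qed.

Lemma parallelogram u v : `|u + v| ^+ 2 + `|u - v| ^+ 2 = 2 * (`|u| ^+ 2 + `|v| ^+ 2).
Proof. by rewrite -!ip_norm !ipE (ipC v u); ring. Qed.

Lemma cvg_ip T (F : set_system T) (FF : Filter F) (f g : T -> H) u v :
  f x @[x --> F] --> u -> g x @[x --> F] --> v ->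
  ip (f x) (g x) @[x --> F] --> ip u v.
Proof.
(* Polarization reduces continuity of [ip] to continuity of the norm. *)
have polar x y : ip x y = 2^-1 * (`|x + y| ^+ 2 - `|x| ^+ 2 - `|y| ^+ 2).
  by rewrite -!ip_norm !ipE (ipC y x); field.
move=> fu gv; rewrite polar.
under eq_fun do rewrite polar.
have sq h z : h x @[x --> F] --> z -> `|h x : H| ^+ 2 @[x --> F] --> `|z| ^+ 2.
  by move=> hz; rewrite expr2; under eq_fun do rewrite expr2; apply: cvgM; exact: cvg_norm.
apply: cvgMr; apply: cvgB; last exact: sq.
by apply: cvgB; [apply: sq; exact: cvgD|exact: sq].
Qed.

End InnerProduct.

(** * Orthogonal decomposition and noncompactness of the unit ball *)

Section Projection.
Context (R : realType) (H : completeNormedModType R) (ip : {dot H for idfun}).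
Hypothesis hip : induces_norm ip.

(** The form of the Cauchy criterion produced both by minimizing sequences, through the
    parallelogram law, and by preimages of a convergent sequence under a coercive operator. *)
Lemma cvg_harmonic_gap (x_ : nat -> H) (C : R) :
  (forall n m, `|x_ n - x_ m| ^+ 2 <= C * (n.+1%:R^-1 + m.+1%:R^-1)) ->
  cvg (x_ @ \oo).
Proof.
move=> close; apply/cauchy_cvgP/cauchy_exP => e e0.
have C0 : 0 < `|C| + 1 by rewrite ltr_wpDl.
have [N _ hN] : \forall n \near \oo, n.+1%:R^-1 < e ^+ 2 / (2 * (`|C| + 1)) :> R.
  have d0 : 0 < e ^+ 2 / (2 * (`|C| + 1)) by rewrite divr_gt0 ?exprn_gt0 ?mulr_gt0.
  exact: (near_infty_natSinv_lt (PosNum d0)).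
exists (x_ N); exists N => // n Nn /=.
rewrite -ball_normE/= -(ltr_pXn2r (n := 2)) ?nnegrE ?normr_ge0 ?(ltW e0)//.
apply: (le_lt_trans (close _ _)).
have := hN N (leqnn N); have := hN n Nn; rewrite /= !ltr_pdivlMr ?mulr_gt0//.
have : 0 < N.+1%:R^-1 :> R by rewrite invr_gt0.
have : 0 < n.+1%:R^-1 :> R by rewrite invr_gt0.
have := ler_norm C.
move: (n.+1%:R^-1) (N.+1%:R^-1) => a b; nra.
Qed.

Lemma closed_subspace_projection (W : set H) :
  W !=set0 -> closed W -> (forall (a : R) x y, W x -> W y -> W (a *: x + y)) ->
  forall u, exists2 x, W x & forall y, W y -> ip (u - x) y = 0.
Proof.
move=> [w0 Ww0] Wc Wl u.
pose D := [set `|u - x| ^+ 2 | x in W].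
have D0 : has_inf D.
  split; first by exists (`|u - w0| ^+ 2), w0.
  by exists 0 => _ [x _ <-]; rewrite sqr_ge0.
pose d := inf D.
have dle x : W x -> d <= `|u - x| ^+ 2.
  by move=> Wx; apply: ge_inf; [exact: D0.2|exists x].
have /choice[x_ xP] (n : nat) : exists x, W x /\ `|u - x| ^+ 2 < d + n.+1%:R^-1.
  have n0 : 0 < n.+1%:R^-1 :> R by rewrite invr_gt0.
  by have [_ [x Wx <-] xd] := inf_adherent n0 D0; exists x.
have close n m : `|x_ n - x_ m| ^+ 2 <= 2 * (n.+1%:R^-1 + m.+1%:R^-1).
  have := parallelogram hip (u - x_ n) (u - x_ m).
  have [Wn xn] := xP n; have [Wm xm] := xP m.
  have -> : u - x_ n - (u - x_ m) = - (x_ n - x_ m).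
    by apply: (ip_inj hip) => w; rewrite !ipE; ring.
  have -> : u - x_ n + (u - x_ m) = 2 *: (u - 2^-1 *: (x_ n + x_ m)).
    by apply: (ip_inj hip) => w; rewrite !ipE; field.
  rewrite normrN normrZ exprMn ger0_norm// => e.
  have Wmid : W (2^-1 *: (x_ n + x_ m)).
    have W0 : W 0 by have := Wl (-1) _ _ Ww0 Ww0; rewrite scaleN1r addNr.
    by rewrite scalerDr; apply: (Wl) => //; rewrite -[_ *: _]addr0; exact: Wl.
  move: (dle _ Wmid) xn xm e; move: (n.+1%:R^-1) (m.+1%:R^-1) => a b.
  lra.
have /cvg_ex[x xx] := cvg_harmonic_gap close.
have Wx : W x.
  apply: (@closed_cvg _ _ _ _ x_ W Wc _ x xx); near=> n; exact: (xP n).1.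
exists x => // y Wy.
have xd : `|u - x| ^+ 2 <= d.
  have cn : `|u - x_ n| ^+ 2 @[n --> \oo] --> `|u - x| ^+ 2.
    have : `|u - x_ n| @[n --> \oo] --> `|u - x|.
      by apply: cvg_norm; apply: cvgB => //; exact: cvg_cst.
    by move=> h; rewrite expr2; under eq_fun do rewrite expr2; exact: cvgM.
  have cd : d + n.+1%:R^-1 @[n --> \oo] --> d.
    by rewrite -[X in _ --> X]addr0; apply: cvgD; [exact: cvg_cst|exact: cvg_harmonic].
  rewrite -(cvg_lim _ cn)// -(cvg_lim _ cd)//.
  apply: ler_lim; [by apply/cvg_ex; eexists; exact: cn|by apply/cvg_ex; eexists; exact: cd|].
  by near=> n; apply: ltW; exact: (xP n).2.
apply: contrapT => /eqP c0.
have y0 : 0 < ip y y.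
  rewrite (ip_norm hip) exprn_gt0// normr_gt0; apply: contraNneq c0 => ->.
  by rewrite ip0r.
(* The coefficient minimizes the distance from [u] along the line through [x] in direction [y]; it
   lowers the squared distance by [ip (u - x) y ^+ 2 / ip y y], which contradicts minimality of
   [x]. *)
have := dle (ip (u - x) y / ip y y *: y + x) (Wl _ _ _ Wy Wx).
move: xd c0; rewrite -!(ip_norm hip) opprD addrA addrAC.
move: (u - x) => z zd c0 h.
have := le_trans zd h; rewrite !ipE (ipC ip y z) leNgt => /negP; apply.
rewrite -subr_gt0.
set a := ip z y; set b := ip y y.
have -> : ip z z - (ip z z - a / b * a + (- (a / b * a) - - (a / b * (a / b * b)))) = a ^+ 2 / b.
  by field; rewrite gt_eqF.
by rewrite divr_gt0// exprn_even_gt0.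
Unshelve. all: end_near. Qed.

(** Gram-Schmidt without normalization, by induction on [l]. A vector is added only if some [y]
    orthogonal to [l] pairs nontrivially with the new [x]; otherwise orthogonality to [l] already
    implies orthogonality to [x]. *)
Lemma finite_orthogonality (l : seq H) : exists n (e : 'I_n -> H),
  forall u, exists c : 'I_n -> R,
    forall x, x \in l -> ip (u - \sum_(i < n) c i *: e i) x = 0.
Proof.
elim: l => [|x l [n [e he]]]; first by exists 0%N, (fun=> 0) => u; exists (fun=> 0).
have [[y [yl yx]]|h] := pselect (exists y, (forall z, z \in l -> ip y z = 0) /\ ip y x != 0).
  exists n.+1, (fun i => if unlift ord0 i is Some j then e j else y) => u.
  have [c hc] := he u.
  set v := u - _ in hc.
  exists (fun i => if unlift ord0 i is Some j then c j else ip v x / ip y x).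
  rewrite big_ord_recl unlift_none.
  under eq_bigr do rewrite !liftK.
  rewrite opprD addrCA addrC -/v => z.
  rewrite ipBl ipZl inE => /predU1P[->|zl]; first by rewrite divfK// subrr.
  by rewrite hc// (yl z)// mulr0 subrr.
exists n, e => u; have [c hc] := he u; exists c => z.
rewrite inE => /predU1P[->|]; last exact: hc.
by apply: contrapT => /eqP h1; apply: h; eexists; split; [exact: hc|].
Qed.

(** A unit vector orthogonal to the centers of finitely many balls of radius 1/2 is at distance at
    least 1 from each center, so it is in none of them. Hence only 0 is orthogonal to all centers,
    and finitely many vectors span [H]. *)
Lemma precompact_unit_ball (C : set H) :
  precompact C -> [set u | `|u| <= 1] `<=` C -> ~ infinite_dimensional H.
Proof.
rewrite precompactE compact_cover => cC ball_C; apply.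
have [|u _|D _ DC] := cC H setT (fun x => ball x 2^-1).
- by move=> x _; exact: ball_open.
- by exists u => //; exact: ballxx.
have [n [e he]] := finite_orthogonality (finmap.enum_fset D).
exists n, e => u; have [c hc] := he u; exists c.
apply/eqP; rewrite -subr_eq0; set z := u - _ in hc *.
apply: contrapT => /negP z0.
have nz : `|(`|z|^-1 *: z)| = 1 by rewrite normrZ normfV normr_id mulVf// normr_eq0.
have [|x xD] := DC (`|z|^-1 *: z); first by apply: subset_closure; apply: ball_C => /=; rewrite nz.
have := hc x xD; set z' := _ *: z in nz * => zx.
rewrite -ball_normE/= -(ltr_pXn2r (n := 2)) ?nnegrE// -(ip_norm hip) ipBl !ipBr.
have -> : ip z' x = 0 by rewrite ipZl zx mulr0.
rewrite (ipC ip x) ipZl zx mulr0 !(ip_norm hip) nz.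
have := sqr_ge0 `|x|; set a := _ ^+ 2 => ? ?; lra.
Qed.

End Projection.

(** * Reducing projections and the spectrum *)

Section Operators.
Context (R : realType) (H : completeNormedModType R) (ip : {dot H for idfun}).
Hypothesis hip : induces_norm ip.

Definition orthogonal_projection (P : H -> H) : Prop :=
  [/\ linear P, forall u v, ip (P u) v = ip u (P v) & forall u, P (P u) = P u].

Definition reduces (P : H -> H) (A : partial_op H) : Prop :=
  forall u, dom A u -> dom A (P u) /\ A (P u) = P (A u).

Definition symmetric_op (A : partial_op H) : Prop :=
  forall u v, dom A u -> dom A v -> ip (A u) v = ip u (A v).

Section OrthogonalProjection.
Context (P : H -> H).
Hypothesis hP : orthogonal_projection P.

Lemma projD u v : P (u + v) = P u + P v.
Proof. by case: hP => l _ _; rewrite -[u]scale1r l !scale1r. Qed.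

Lemma proj0 : P 0 = 0.
Proof. by apply: (addrI (P 0)); rewrite -projD !addr0. Qed.

Lemma projZ a u : P (a *: u) = a *: P u.
Proof. by case: hP => l _ _; rewrite -[_ *: _ in LHS]addr0 l proj0 addr0. Qed.

Lemma projN u : P (- u) = - P u.
Proof. by rewrite -scaleN1r projZ scaleN1r. Qed.

Lemma projB u v : P (u - v) = P u - P v.
Proof. by rewrite projD projN. Qed.

Lemma projK u : P (P u) = P u.
Proof. by case: hP. Qed.

Lemma ip_proj u v : ip (P u) v = ip u (P v).
Proof. by case: hP. Qed.

Lemma ip_projr u v : P v = v -> ip (P u) v = ip u v.
Proof. by move=> e; rewrite ip_proj e. Qed.

Lemma ip_proj_sqr u : ip (P u) u = `|P u| ^+ 2.
Proof. by rewrite -(ip_norm hip) [RHS]ip_proj projK ipC. Qed.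

Lemma range_proj u : range P u <-> P u = u.
Proof. by split=> [[v _ <-]|<-]; [exact: projK|exists u]. Qed.

Lemma compl_proj : orthogonal_projection (compl P).
Proof.
split=> [a u v|u v|u]; rewrite /compl.
- by case: hP => l _ _; rewrite l scalerBr opprD addrACA.
- by rewrite ipBl ipBr ip_proj.
- by rewrite projB projK subrr subr0.
Qed.

Lemma compl_projK u : P (compl P u) = 0.
Proof. by rewrite /compl projB projK subrr. Qed.

Lemma proj_complK u : compl P (P u) = 0.
Proof. by rewrite /compl projK subrr. Qed.

Lemma norm_proj u : `|P u| <= `|u|.
Proof.
apply: (norm_le_ip hip) => // w; rewrite ip_proj.
have Pw : `|P w| <= `|w|.
  have [->|Pw0] := eqVneq (P w) 0; first by rewrite normr0.
  rewrite -(ler_pM2r (_ : 0 < `|P w|)) ?normr_gt0// -expr2 -(ip_norm hip).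
  by rewrite ip_proj projK; exact: ip_le.
by apply: (le_trans (cauchy_schwarz hip _ _)); rewrite ler_wpM2l.
Qed.

Lemma proj_continuous : continuous P.
Proof.
move=> u; apply/cvgrPdist_le => e e0; near=> v.
rewrite -projB; apply: le_trans (norm_proj _) _.
by near: v; exact: cvgr_dist_le.
Unshelve. all: end_near. Qed.

End OrthogonalProjection.

Lemma compl_reduces (P : H -> H) (A : partial_op H) : linear_op A ->
  reduces P A -> reduces (compl P) A.
Proof.
move=> lA rP u Au; rewrite /compl; have [APu e] := rP _ Au.
have := lA (-1) _ _ APu Au; by rewrite !scaleN1r !(addrC (- _)) e.
Qed.

Section LinearOp.
Context (A : partial_op H).
Hypothesis lA : linear_op A.

Lemma opZD a u v : dom A u -> dom A v -> A (a *: u + v) = a *: A u + A v.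
Proof. by move=> du dv; have [] := lA a du dv. Qed.

Lemma dom0 u : dom A u -> dom A 0.
Proof. by move=> du; have [+ _] := lA (-1) du du; rewrite scaleN1r addNr. Qed.

Lemma op0 u : dom A u -> A 0 = 0.
Proof.
move=> du; have [_ +] := lA (-1) du du; rewrite scaleN1r addNr => ->.
by rewrite scaleN1r addNr.
Qed.

Lemma domD u v : dom A u -> dom A v -> dom A (u + v).
Proof. by move=> du dv; have [+ _] := lA 1 du dv; rewrite scale1r. Qed.

Lemma opD u v : dom A u -> dom A v -> A (u + v) = A u + A v.
Proof. by move=> du dv; have [_] := lA 1 du dv; rewrite !scale1r. Qed.

Lemma domZ a u : dom A u -> dom A (a *: u).
Proof. by move=> du; have [+ _] := lA a du (dom0 du); rewrite addr0. Qed.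

Lemma opZ a u : dom A u -> A (a *: u) = a *: A u.
Proof.
move=> du; have [_ +] := lA a du (dom0 du).
by rewrite addr0 (op0 du) addr0.
Qed.

Lemma domB u v : dom A u -> dom A v -> dom A (u - v).
Proof. by move=> du dv; apply: domD => //; rewrite -scaleN1r; exact: domZ. Qed.

Lemma opB u v : dom A u -> dom A v -> A (u - v) = A u - A v.
Proof.
move=> du dv; rewrite opD//; last by rewrite -scaleN1r; exact: domZ.
by rewrite -scaleN1r opZ// scaleN1r.
Qed.

End LinearOp.

Lemma self_adjoint_symmetric A : self_adjoint ip A -> symmetric_op A.
Proof. by move=> [_ _ sa] u v du dv; have [_ /(_ (conj dv erefl))] := sa v (A v); exact. Qed.

Lemma dense_seq (D : set H) : dense D ->
  forall u : H, exists2 x_ : nat -> H, (forall n, D (x_ n)) & x_ n @[n --> \oo] --> u.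
Proof.
move=> dD u.
have /choice[x_ xP] (n : nat) : exists x, D x /\ `|u - x| < n.+1%:R^-1.
  have [] := dD (ball u n.+1%:R^-1) _ (ball_open _ _); rewrite ?invr_gt0//.
    by exists u; exact: ballxx.
  by move=> x [/= + Dx]; rewrite -ball_normE; exists x.
exists x_; first by move=> n; exact: (xP n).1.
apply/cvgrPdist_lt => e e0; near=> n; apply: lt_trans (xP n).2 _.
by near: n; exact: (near_infty_natSinv_lt (PosNum e0)).
Unshelve. all: end_near. Qed.

Section Spectrum.
Context (A : partial_op H) (P : H -> H).
Hypothesis sA : self_adjoint ip A.
Hypothesis hP : orthogonal_projection P.
Hypothesis rP : reduces P A.

Let lA : linear_op A. Proof. by case: sA. Qed.

(** Coercivity makes [A - lam] injective on [range P] and its range closed. The component of a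
    vector orthogonal to that range lies in the domain of the adjoint, hence in [dom A], and is
    annihilated by [A - lam]; coercivity then makes it 0, which gives surjectivity. *)
Lemma coercive_not_spectrum (lam c : R) : 0 < c ->
  (forall v, dom A v -> P v = v -> c * `|v| <= `|A v - lam *: v|) ->
  ~ spectrum_on (range P) A lam.
Proof.
move=> c0 coer; apply; have [_ dA saA] := sA.
pose D := [set v | dom A v /\ P v = v].
have D0 : D 0.
  have [z [_ Az]] := dA setT (ex_intro _ 0 Logic.I) openT.
  by split; [exact: dom0 Az|exact: proj0].
have DB u v : D u -> D v -> D (u - v).
  by move=> [du Pu] [dv Pv]; split; [exact: domB|rewrite (projB hP) Pu Pv].
have DZ a v : D v -> D (a *: v).
  by move=> [dv Pv]; split; [exact: domZ|rewrite (projZ hP) Pv].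
have DD u v : D u -> D v -> D (u + v).
  by move=> [du Pu] [dv Pv]; split; [exact: domD|rewrite (projD hP) Pu Pv].
pose T v := A v - lam *: v.
have TB u v : D u -> D v -> T (u - v) = T u - T v.
  by move=> [du _] [dv _]; rewrite /T opB//; apply: (ip_inj hip) => z; rewrite !ipE; ring.
have Tinj u v : D u -> D v -> T u = T v -> u = v.
  move=> Du Dv e; have [d Pd] := DB _ _ Du Dv.
  have := coer _ d Pd; rewrite -[A _ - _]/(T _) TB// e subrr normr0.
  by rewrite pmulr_rle0// normr_le0 subr_eq0 => /eqP.
pose W := [set T v | v in D].
have W0 : W !=set0 by exists (T 0), 0.
have Wl (a : R) x y : W x -> W y -> W (a *: x + y).
  move=> [u Du <-] [v Dv <-]; exists (a *: u + v); first by apply: DD => //; exact: DZ.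
  case: Du Dv => du _ [dv _]; rewrite /T (opZD lA)//.
  by apply: (ip_inj hip) => z; rewrite !ipE; ring.
have Wc : closed W.
  move=> x Wx.
  have /choice[v_ vP] (n : nat) : exists v, D v /\ `|x - T v| < n.+1%:R^-1.
    have [|_ [[v Dv <-]]] := Wx (ball x n.+1%:R^-1).
      by apply: nbhsx_ballx; rewrite invr_gt0.
    by rewrite -ball_normE => ?; exists v.
  have vC n m : `|v_ n - v_ m| ^+ 2 <= 2 * c^-1 ^+ 2 * (n.+1%:R^-1 + m.+1%:R^-1).
    have [Dn xn] := vP n; have [Dm xm] := vP m.
    have [dnm Pnm] := DB _ _ Dn Dm; have := coer _ dnm Pnm.
    rewrite -[A _ - _]/(T _) TB// => h.
    have tri : `|T (v_ n) - T (v_ m)| <= `|x - T (v_ n)| + `|x - T (v_ m)|.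
      rewrite (distrC x (T (v_ n))) (le_trans _ (ler_normD _ _))//.
      by rewrite addrA subrK.
    have n1 : n.+1%:R^-1 <= 1 :> R by rewrite invf_le1// ler1n.
    have m1 : m.+1%:R^-1 <= 1 :> R by rewrite invf_le1// ler1n.
    have n0 : 0 < n.+1%:R^-1 :> R by rewrite invr_gt0.
    have m0 : 0 < m.+1%:R^-1 :> R by rewrite invr_gt0.
    have {}h : `|v_ n - v_ m| <= c^-1 * (n.+1%:R^-1 + m.+1%:R^-1).
      rewrite mulrC ler_pdivlMr// mulrC.
      by move: h tri xn xm; move: (n.+1%:R^-1) (m.+1%:R^-1) => a b; lra.
    (* Both reciprocals are at most 1, so the square of their sum is at most twice their sum; this
       is the factor 2 in [vC]. *)
    apply: (@le_trans _ _ ((c^-1 * (n.+1%:R^-1 + m.+1%:R^-1)) ^+ 2)).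
      by rewrite ler_sqr ?nnegrE// mulr_ge0 ?invr_ge0 ?addr_ge0// ltW.
    rewrite exprMn [leRHS]mulrAC [leRHS]mulrC; apply: ler_wpM2l; first exact: sqr_ge0.
    move: n0 m0 n1 m1; move: (n.+1%:R^-1) (m.+1%:R^-1) => a b; nra.
  have /cvg_ex[v vv] := cvg_harmonic_gap vC.
  have Tx : T (v_ n) @[n --> \oo] --> x.
    apply/cvgrPdist_lt => e e0; near=> n; apply: lt_trans (vP n).2 _.
    by near: n; exact: (near_infty_natSinv_lt (PosNum e0)).
  have Pv : P v = v.
    have c1 : P (v_ n) @[n --> \oo] --> P v.
      by apply: continuous_cvg => //; exact: proj_continuous.
    rewrite (_ : (fun n => P (v_ n)) = v_) in c1; first exact: (cvg_unique _ c1 vv).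
    by apply/funext => n; exact: (vP n).1.2.
  have [|dv Av] := (saA v (x + lam *: v)).1.
    move=> z dz.
    have c1 : ip (A z) (v_ n) @[n --> \oo] --> ip (A z) v.
      by apply: cvg_ip => //; exact: cvg_cst.
    rewrite (_ : (fun n => ip (A z) (v_ n)) = (fun n => ip z (T (v_ n) + lam *: v_ n))) in c1.
      apply: (cvg_unique _ c1) => //; apply: cvg_ip => //; first exact: cvg_cst.
      by apply: cvgD => //; exact: cvgZr.
    by apply/funext => n; rewrite (self_adjoint_symmetric sA dz (vP n).1.1) subrK.
  by exists v => //; rewrite /T Av addrK.
have surj u : range P u -> exists2 v, D v & T v = u.
  move=> /(range_proj hP) Pu.
  have [x Wx ortho] := closed_subspace_projection hip W0 Wc Wl u.
  have Px : P x = x.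
    case: Wx => v [dv Pv] <-; rewrite /T (projB hP) (projZ hP) Pv.
    by rewrite -(rP dv).2 Pv.
  (* The adjoint condition has to hold for every [v] in [dom A]. Since [u - x] lies in [range P],
     [v] may be replaced by [P v], for which orthogonality to [W] applies. *)
  have [|dz Az] := (saA (u - x) (lam *: (u - x))).1.
    move=> v dv; rewrite ipZr -ipZl; apply/eqP; rewrite -subr_eq0 -ipBl.
    rewrite -[u - x](_ : P (u - x) = _); last by rewrite (projB hP) Pu Px.
    rewrite -(ip_proj hP) (projB hP) (projZ hP) -(rP dv).2 ipC ortho//.
    exists (P v) => //; split; [exact: (rP dv).1|exact: projK].
  have := coer _ dz; rewrite (projB hP) Pu Px => /(_ erefl).
  rewrite Az subrr normr0 pmulr_rle0// normr_le0 subr_eq0 => /eqP ->.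
  by case: Wx => v; exists v.
pose K u := xget 0 [set v | D v /\ T v = u].
have KP u : range P u -> D (K u) /\ T (K u) = u.
  move=> Vu; rewrite /K; case: xgetP => [v _ //|/(_ _)].
  by have [v Dv Tv] := surj _ Vu => /(_ v) /(_ (conj Dv Tv)).
exists K; split.
- move=> u Vu; have [[dK PK] TK] := KP _ Vu; split=> //.
  by apply/(range_proj hP).
- move=> v dv /(range_proj hP) Pv.
  have VT : range P (A v - lam *: v).
    by apply/(range_proj hP); rewrite (projB hP) (projZ hP) Pv -(rP dv).2 Pv.
  by split=> //; have [DK TK] := KP _ VT; apply: Tinj.
- exists c^-1 => u Vu; have [[dK PK] TK] := KP _ Vu.
  rewrite mulrC ler_pdivlMr// mulrC -[in leRHS]TK.
  exact: coer.
Unshelve. all: end_near. Qed.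

(* The infimum of the numerical range is in the spectrum. *)
Lemma spectrum_nonempty (m0 : R) v0 :
  (forall v, dom A v -> P v = v -> m0 * `|v| ^+ 2 <= ip (A v) v) ->
  dom A v0 -> P v0 = v0 -> v0 != 0 ->
  exists lam, spectrum_on (range P) A lam.
Proof.
move=> lb dv0 Pv0 v00.
pose N := [set ip (A v) v / `|v| ^+ 2 | v in [set v | [/\ dom A v, P v = v & v != 0]]].
have Ninf : has_inf N.
  split; first by exists (ip (A v0) v0 / `|v0| ^+ 2), v0.
  exists m0 => _ [v [dv Pv v0'] <-].
  by rewrite ler_pdivlMr ?exprn_gt0 ?normr_gt0//; exact: lb.
pose m := inf N; exists m => -[K [K1 K2 [C KC]]].
have form_ge0 v : dom A v -> P v = v -> 0 <= ip (A v - m *: v) v.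
  move=> dv Pv; rewrite ipBl ipZl (ip_norm hip) subr_ge0.
  have [->|v1] := eqVneq v 0; first by rewrite normr0 ip0r expr0n mulr0.
  rewrite -ler_pdivlMr ?exprn_gt0 ?normr_gt0//.
  by apply: ge_inf; [exact: Ninf.2|exists v].
have Cp : 0 < `|C| + 1 by rewrite ltr_wpDl.
(* The form of [A - m] is nonnegative at [v - t *: K v]. Since [(A - m) K v = v], this reads
   [0 <= ip T v - 2 t |v|^2 + t^2 ip v (K v)], where [T = (A - m) v]. With [t = 1 / (|C| + 1)] the
   last term is at most [t |v|^2], so the form exceeds [t |v|^2], and [m] could not be the
   infimum. *)
have step v : dom A v -> P v = v -> `|v| ^+ 2 <= (`|C| + 1) * ip (A v - m *: v) v.
  move=> dv Pv; have Vv : range P v by apply/(range_proj hP).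
  have [dK /(range_proj hP) PK TK] := K1 _ Vv.
  have vKv : ip v (K v) <= (`|C| + 1) * `|v| ^+ 2.
    apply: (le_trans (ip_le hip _ _)); have := KC _ Vv; have := ler_norm C.
    have := normr_ge0 v; move: `|v| `|K v| `|C| => a b d; nra.
  pose t := (`|C| + 1)^-1.
  have := form_ge0 (v - t *: K v).
  have dtK : dom A (t *: K v) by exact: domZ.
  move=> /(_ (domB lA dv dtK)); rewrite (projB hP) (projZ hP) Pv PK => /(_ erefl).
  rewrite (opB lA)// (opZ lA)//.
  have -> : A v - t *: A (K v) - m *: (v - t *: K v) = A v - m *: v - t *: v.
    apply: (ip_inj hip) => z; have e : ip v z = ip (A (K v)) z - m * ip (K v) z.
      by rewrite -[in LHS]TK !ipE.
    by rewrite !ipE e; ring.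
  set T := A v - m *: v; rewrite ipBl ipBr ipZr.
  have -> : ip T (K v) = `|v| ^+ 2.
    rewrite /T ipBl (self_adjoint_symmetric sA)// ipZl -ipZr -ipBr TK.
    by rewrite (ip_norm hip).
  rewrite ipZl ipBr ipZr (ip_norm hip) => h.
  have t1 : t * (`|C| + 1) = 1 by rewrite mulVf// gt_eqF.
  have t0 : 0 < t by rewrite invr_gt0.
  move: h vKv t1 t0 Cp; move: (ip T v) (ip v (K v)) (`|v| ^+ 2) (`|C| + 1) => a b d e.
  move=> h1 h2 h3 h4 h5.
  have tb : t * b <= d by rewrite -[d]mul1r -h3 -mulrA ler_pM2l.
  have ttb : t * (t * b) <= t * d by rewrite ler_pM2l.
  have : t * d <= a by lra.
  by move=> h6; have : e * (t * d) <= e * a; [rewrite ler_pM2l|rewrite mulrA (mulrC e) h3 mul1r].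
have := inf_adherent (_ : 0 < (`|C| + 1)^-1) Ninf.
rewrite invr_gt0 => /(_ Cp)[_ [v [dv Pv v1] <-]].
rewrite -/m ltr_pdivrMr ?exprn_gt0 ?normr_gt0// => lt.
have := step _ dv Pv; rewrite ipBl ipZl (ip_norm hip) leNgt => /negP; apply.
rewrite mulrC -ltr_pdivlMr// ltrBlDl.
by rewrite [X in _ + X]mulrC -mulrDl.
Qed.

End Spectrum.
End Operators.

(** * Spectral cutoffs *)

Section SpectralMeasure.
Context (R : realType) (H : completeNormedModType R) (ip : {dot H for idfun}).
Hypothesis hip : induces_norm ip.
Context (A : partial_op H) (E : set R -> H -> H).
Hypothesis sA : self_adjoint ip A.
Hypothesis nnA : nonnegative_op ip A.
Hypothesis hE : is_spectral_measure ip A E.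
Implicit Types (nu : {measure set (measurableTypeR R) -> \bar R}) (X Y : set R) (u w : H).

Let lA : linear_op A. Proof. by case: sA. Qed.

Lemma eq_integral_off_null nu (N : set R) (f g : R -> R) :
  measurable N -> nu N = 0 -> measurable_fun setT f -> measurable_fun setT g ->
  (forall x, ~ N x -> f x = g x) ->
  (\int[nu]_x (f x)%:E = \int[nu]_x (g x)%:E)%E.
Proof.
move=> mN N0 mf mg fg; apply: ae_eq_integral => //.
- exact/measurable_EFinP.
- exact/measurable_EFinP.
- exists N; split => // x /= h; apply: contrapT => Nx; apply: h => _.
  by rewrite fg.
Qed.

Lemma spectral_proj X : measurable X -> orthogonal_projection ip (E X).
Proof.
case: hE => h1 h2 _ _ mX; have [lE sE] := h1 X mX; split => // u.
by rewrite -h2// setIid.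
Qed.

Lemma spectral_set0 u : E set0 u = 0.
Proof.
case: hE => _ _ _ /(_ u)[nu [nuE _ _]].
have := nuE set0 measurable0; rewrite measure0 => -[e].
have hP := spectral_proj measurable0.
apply/eqP; rewrite -normr_eq0 -sqrf_eq0 -(ip_norm hip) (ip_proj hP).
by rewrite (projK hP) ipC -e.
Qed.

Lemma spectral_disjoint X Y u : measurable X -> measurable Y -> X `&` Y = set0 ->
  E X (E Y u) = 0.
Proof.
by case: hE => _ h2 _ _ mX mY XY0; rewrite -h2// XY0 spectral_set0.
Qed.

(** Additivity is available for the scalar measures only. It passes to the projections by expanding
    the squared norm of the difference of both sides, with the cross terms removed by
    disjointness. *)
Lemma spectral_compl X u : measurable X -> E (~` X) u = compl (E X) u.
Proof.
move=> mX; have mXc := measurableC mX.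
case: hE => _ _ h3 /(_ u)[nu [nuE _ _]].
have hP := spectral_proj mX; have hQ := spectral_proj mXc.
have : nu (X `|` ~` X) = (nu X + nu (~` X))%E by exact: (measureU nu mX mXc (setICr X)).
rewrite setUv !nuE// h3 -EFinD => -[e].
apply/eqP; rewrite eq_sym -subr_eq0 -normr_eq0 -sqrf_eq0 -(ip_norm hip) /compl.
have e1 : ip (E X u) (E X u) = ip (E X u) u by rewrite (ip_proj hP) (projK hP) ipC.
have e2 : ip (E (~` X) u) (E (~` X) u) = ip (E (~` X) u) u.
  by rewrite (ip_proj hQ) (projK hQ) ipC.
have e3 : ip (E X u) (E (~` X) u) = 0.
  by rewrite (ip_proj hP) spectral_disjoint ?ip0r// setICr.
rewrite !ipBl !ipBr e1 e2 (ipC ip (E (~` X) u) (E X u)) e3 !(ipC ip u (E _ u)) e.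
by apply/eqP; ring.
Qed.

Lemma spectral_null nu X u : measurable X -> E X u = u ->
  (forall Y, measurable Y -> nu Y = (ip (E Y u) u)%:E) -> nu (~` X) = 0.
Proof.
move=> mX Eu nuE; rewrite nuE; last exact: measurableC.
by rewrite spectral_compl// /compl Eu subrr ip0l.
Qed.

Lemma dom_spectral_bounded X (a : R) u : measurable X -> X `<=` [set x | `|x| <= a] ->
  E X u = u -> dom A u.
Proof.
move=> mX Xa Eu; case: hE => _ _ h3 /(_ u)[nu [nuE domE _]].
apply/domE.
have null := spectral_null mX Eu nuE.
have mf : measurable_fun setT (fun x : R => x ^+ 2) by exact: measurable_funX.
have mg : measurable_fun setT (fun x : R => Num.min (x ^+ 2) (a ^+ 2)).
  exact: measurable_minr.
rewrite (eq_integral_off_null (measurableC mX) null mf mg); last first.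
  move=> x /contrapT /Xa /= xa; rewrite min_l//.
  rewrite -(@real_normK _ x) ?num_real// ler_sqr ?nnegrE//.
  by rewrite (le_trans _ xa).
apply: (@le_lt_trans _ _ (\int[nu]_x (cst (a ^+ 2)%:E) x)%E).
  apply: ge0_le_integral => //.
  - by move=> x _; rewrite lee_fin le_min !sqr_ge0.
  - exact/measurable_EFinP.
  - by move=> x _; rewrite lee_fin ge_min lexx orbT.
by rewrite integral_cst// nuE// -EFinM ltry.
Qed.

(** The scalar measure of a vector in the range of [E X] vanishes off [X], so the integrand may be
    changed there. Each use picks a [g] of constant sign, so that the tools for nonnegative
    integrands apply. *)
Lemma spectral_form_eq nu X u (g : R -> R) : dom A u ->
  (dom A u -> (ip (A u) u)%:E = (\int[nu]_x x%:E)%E) ->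
  (forall Y, measurable Y -> nu Y = (ip (E Y u) u)%:E) ->
  measurable X -> E X u = u -> measurable_fun setT g ->
  (forall x, X x -> g x = x) ->
  (ip (A u) u)%:E = (\int[nu]_x (g x)%:E)%E.
Proof.
move=> du form nuE mX Eu mg gX; rewrite form//.
apply: (@eq_integral_off_null nu (~` X)) => //.
- exact: measurableC.
- exact: spectral_null mX Eu nuE.
- by move=> x /contrapT /gX.
Qed.

(** A vector in the range of the projection for [[-n, 0[] lies in [dom A], and its form is the
    integral of a negative function, yet it is nonnegative by hypothesis. So its measure charges
    nothing in that interval and the vector is 0. The intervals exhaust the negative axis. *)
Lemma spectral_neg u : E `]-oo, 0[%classic u = 0.
Proof.
case: hE => _ h2 h3 h4.
have mN (n : nat) : measurable (`[- n%:R, 0[%classic : set R) by [].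
have En (n : nat) w : E `[- n%:R, 0[%classic w = 0.
  have hP := spectral_proj (mN n).
  set v := E _ w.
  have Ev : E `[- n%:R, 0[%classic v = v by exact: (projK hP).
  have dv : dom A v.
    apply: (dom_spectral_bounded (mN n) (a := n%:R) _ Ev) => x /=.
    rewrite in_itv/= => /andP[nx x0]; rewrite ler_norml nx (le_trans (ltW x0))//.
  have [nu [nuE _ form]] := h4 v.
  pose g (x : R) : R := Num.max (- x) 0.
  have mg : measurable_fun setT g.
    by apply: measurable_maxr => //; exact: measurableT_comp.
  have e : (ip (A v) v)%:E = (\int[nu]_x - (g x)%:E)%E.
    apply: (spectral_form_eq (g := fun x => - g x) dv form nuE (mN n) Ev).
      exact: measurableT_comp.
    by move=> x /=; rewrite in_itv/= => /andP[_ x0]; rewrite /g max_l ?opprK// oppr_ge0 ltW.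
  have g0 x : (0 <= (g x)%:E)%E by rewrite lee_fin le_max lexx orbT.
  rewrite integral_ge0N// in e.
  have I0 : (\int[nu]_x `|(g x)%:E| = 0)%E.
    apply/eqP; rewrite eq_le integral_ge0// andbT.
    under eq_integral do rewrite gee0_abs//.
    by rewrite -oppe_ge0 -e lee_fin; exact: nnA.
  have mge : measurable_fun setT (fun x : R => (g x)%:E) by exact/measurable_EFinP.
  have [N [mNN N0 subN]] := (ae_eq_integral_abs nu measurableT mge).1 I0.
  have := nuE _ (mN n); rewrite Ev (ip_norm hip).
  rewrite (_ : nu _ = 0%E); last first.
    apply: (subset_measure0 _ _ _ N0) => // x /=; rewrite in_itv/= => /andP[_ x0].
    apply: subN => /= /(_ Logic.I) [] /eqP.
    by rewrite /g max_l ?oppr_eq0 ?oppr_ge0 ?(ltW x0)// lt_eqF.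
  by move=> [/esym/eqP]; rewrite sqrf_eq0 normr_eq0 => /eqP.
have [nu [nuE _ _]] := h4 u.
have mneg : measurable (`]-oo, 0[%classic : set R) by [].
have hP := spectral_proj mneg.
suff : nu `]-oo, 0[%classic = 0%E.
  rewrite nuE// (ip_proj_sqr hip hP).
  by move=> [/eqP]; rewrite sqrf_eq0 normr_eq0 => /eqP.
pose U := \bigcup_n (`[- n%:R, 0[%classic : set (measurableTypeR R)).
have sub : (`]-oo, 0[%classic : set (measurableTypeR R)) `<=` U.
  move=> x /=; rewrite in_itv/= => x0; exists (Num.truncn `|x|).+1 => //=.
  by rewrite in_itv/= x0 andbT lerNl -ltr0_norm// ltW// truncnS_gt.
have U0 : nu.-negligible U.
  have nun (n : nat) : nu `[- n%:R, 0[%classic = 0%E by rewrite nuE// En ip0l.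
  by apply: negligible_bigcup => n; apply/negligibleP => //; exact: nun.
exact: measure_negligible (negligibleS sub U0).
Qed.

Lemma spectral_form_ge0 nu u : dom A u ->
  (dom A u -> (ip (A u) u)%:E = (\int[nu]_x x%:E)%E) ->
  (forall Y, measurable Y -> nu Y = (ip (E Y u) u)%:E) ->
  (ip (A u) u)%:E = (\int[nu]_x (Num.max x 0 : R)%:E)%E.
Proof.
move=> du form nuE.
have mneg : measurable (`]-oo, 0[%classic : set R) by [].
apply: (spectral_form_eq (X := ~` `]-oo, 0[) du form nuE).
- exact: measurableC.
- by rewrite spectral_compl// /compl spectral_neg subr0.
- exact: measurable_maxr.
- by move=> x /= /negP; rewrite in_itv/= -leNgt => x0; rewrite max_l.
Qed.

Section Cutoff.
Context (a : R).
Hypothesis a0 : 0 <= a.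
Local Notation X := `[0, a]%classic.
Let mX : measurable X. Proof. exact: measurable_itv. Qed.
Let hP := spectral_proj mX.

Lemma dom_cutoff u : dom A (E X u).
Proof.
apply: (dom_spectral_bounded mX (a := a)); last exact: (projK hP).
by move=> x /=; rewrite in_itv/= => /andP[x0 xa]; rewrite ger0_norm.
Qed.

Lemma cutoff_form_le u : E X u = u -> ip (A u) u <= a * `|u| ^+ 2.
Proof.
move=> Eu; have du : dom A u by rewrite -Eu; exact: dom_cutoff.
case: hE => _ _ h3 /(_ u)[nu [nuE domE form]].
rewrite -lee_fin.
rewrite (spectral_form_eq (g := fun x => Num.min (Num.max x 0) a) du form nuE mX Eu).
- have := nuE setT measurableT; rewrite h3 (ip_norm hip) => nuT.
  rewrite EFinM -nuT -(integral_cst nu measurableT).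
  apply: ge0_le_integral => //.
  + by move=> x _; rewrite lee_fin le_min le_max lexx orbT.
  + by apply/measurable_EFinP; apply: measurable_minr => //; exact: measurable_maxr.
  + by move=> x _; rewrite lee_fin ge_min lexx orbT.
- by apply: measurable_minr => //; exact: measurable_maxr.
- by move=> x /=; rewrite in_itv/= => /andP[x0 xa]; rewrite max_l// min_l.
Qed.

Lemma cutoff_compl_form_ge u : dom A u -> E X u = 0 -> a * `|u| ^+ 2 <= ip (A u) u.
Proof.
move=> du Eu; case: hE => _ _ h3 /(_ u)[nu [nuE domE form]].
have mY : measurable (`]a, +oo[%classic : set R) by [].
have mN : measurable (`]-oo, 0[%classic : set R) by [].
have EYu : E `]a, +oo[ u = u.
  have -> : `]a, +oo[%classic = ~` X `&` ~` `]-oo, 0[%classic :> set R.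
    apply/seteqP; split => x /=; rewrite !in_itv/= ?andbT.
      move=> ax; split; last by apply/negP; rewrite -leNgt (le_trans a0)// ltW.
      by apply/negP; rewrite negb_and -(ltNge a) ax orbT.
    by move=> [/negP + /negP]; rewrite -leNgt => + x0; rewrite x0/= -ltNge.
  case: hE => _ h2 _ _; rewrite h2; [|exact: measurableC|exact: measurableC].
  by rewrite !spectral_compl// /compl spectral_neg subr0 Eu subr0.
rewrite -lee_fin.
rewrite (spectral_form_eq (g := fun x => Num.max x a) du form nuE mY EYu).
- have := nuE setT measurableT; rewrite h3 (ip_norm hip) => nuT.
  rewrite EFinM -nuT -(integral_cst nu measurableT).
  apply: ge0_le_integral => //.
  + by apply/measurable_EFinP; exact: measurable_maxr.
  + by move=> x _; rewrite lee_fin le_max lexx orbT.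
- exact: measurable_maxr.
- by move=> x /=; rewrite in_itv/= andbT => ax; rewrite max_l// ltW.
Qed.

(* By orthogonality the spectral measure of [u + w] is the sum of those of [u] and
   [w], so the quadratic form of [A] is additive. *)
Lemma cutoff_form_orthogonal u w : dom A u -> dom A w -> E X u = u -> E X w = 0 ->
  ip (A u) w = 0.
Proof.
move=> du dw Eu Ew; case: hE => h1 _ _ h4.
have duw := domD lA du dw.
have [nu1 [n1 _ f1]] := h4 u; have [nu2 [n2 _ f2]] := h4 w.
have [nu [n3 _ f3]] := h4 (u + w).
have cross Y : measurable Y -> ip (E Y u) w = 0.
  by move=> mY; case: hE => _ h2 _ _; rewrite -Eu -h2// setIC h2// (ip_proj hP) Ew ip0r.
have nuD Y : measurable Y -> nu Y = measure_add nu1 nu2 Y.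
  move=> mY; have hY := spectral_proj mY.
  rewrite n3// /measure_add/= /msum !big_ord_recl big_ord0/= adde0 n1// n2// -EFinD.
  by rewrite (projD hY) !ipE cross// (ip_proj hY w) (ipC ip w) cross// addr0 add0r.
have g0 (x : R) : (0 <= (Num.max x 0 : R)%:E)%E by rewrite lee_fin le_max lexx orbT.
have mg : measurable_fun setT (fun x : R => (Num.max x 0 : R)%:E).
  by apply/measurable_EFinP; exact: measurable_maxr.
have := spectral_form_ge0 duw f3 n3.
rewrite (eq_measure_integral (measure_add nu1 nu2)); last by move=> Y mY _; exact: nuD.
rewrite ge0_integral_measure_add// -(spectral_form_ge0 du f1 n1).
rewrite -(spectral_form_ge0 dw f2 n2) -EFinD (opD lA du dw) => -[].
rewrite !ipE (self_adjoint_symmetric sA dw du) (ipC ip w); lra.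
Qed.

(** Pairing with [w] in [dom A] and splitting by [E X], the mixed terms of the form vanish; both
    [ip (A (E X u)) w] and [ip (E X (A u)) w] reduce to the form of [A] between [E X u] and [E X w].
    Density of the domain concludes. *)
Lemma cutoff_reduces : reduces (E X) A.
Proof.
move=> u du; have dEu := dom_cutoff u; split => //.
have [_ dA _] := sA.
have hQ := compl_proj hP.
have dc v : dom A v -> dom A (compl (E X) v).
  by move=> dv; exact: (domB lA dv (dom_cutoff v)).
have key w : dom A w -> ip (A (E X u)) w = ip (E X (A u)) w.
  move=> dw; rewrite (ip_proj hP).
  have := cutoff_form_orthogonal dEu (dc _ dw) (projK hP _) (compl_projK hP _).
  have := cutoff_form_orthogonal (dom_cutoff w) (dc _ du) (projK hP _) (compl_projK hP _).
  rewrite /compl !ipBr (self_adjoint_symmetric sA dEu (dom_cutoff w)).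
  rewrite (self_adjoint_symmetric sA du (dom_cutoff w)) !(ipC ip (A (E X w))).
  by lra.
apply: (ip_inj hip) => w.
have [x_ xD xw] := dense_seq dA w.
have c1 : ip (A (E X u)) (x_ n) @[n --> \oo] --> ip (A (E X u)) w.
  by apply: cvg_ip => //; exact: cvg_cst.
have c2 : ip (E X (A u)) (x_ n) @[n --> \oo] --> ip (E X (A u)) w.
  by apply: cvg_ip => //; exact: cvg_cst.
apply: (cvg_unique _ c1) => //.
by rewrite (_ : (fun n => _) = (fun n => ip (E X (A u)) (x_ n)))//; apply/funext => n; exact: key.
Qed.

(** Only the form is known to lie between 0 and [a]. With [v = A (E X u)], the form at
    [E X u + s *: v] minus the form at [E X u - s *: v] is [4 s |v|^2]; bounding the first from
    above and the second from below controls [|v|]. *)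
Lemma cutoff_op_bounded u : `|A (E X u)| <= a * `|u|.
Proof.
have dEu := dom_cutoff u; have := (cutoff_reduces dEu).2; rewrite (projK hP) => e.
set v := A (E X u) in e *.
have Ev : E X v = v by rewrite -e.
have dv : dom A v by rewrite -Ev; exact: dom_cutoff.
have [v0|v0] := eqVneq v 0; first by rewrite v0 normr0 mulr_ge0.
have [u0|u0] := eqVneq (E X u) 0.
  by rewrite /v u0 (op0 lA dv) normr0 mulr_ge0.
have nv : 0 < `|v| by rewrite normr_gt0.
have nu : 0 < `|E X u| by rewrite normr_gt0.
apply: (@le_trans _ _ (a * `|E X u|)); last by rewrite ler_wpM2l// (norm_proj hip hP).
(* This scaling gives the two vectors polarized below the same norm. *)
pose s := `|E X u| / `|v|.
have s0 : 0 < s by rewrite divr_gt0.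
have dsv : dom A (s *: v) by exact: domZ.
have Es : E X (s *: v) = s *: v by rewrite (projZ hP) Ev.
have le1 := cutoff_form_le (u := E X u + s *: v).
have := le1; rewrite (projD hP) Es (projK hP) => /(_ erefl).
have := nnA (domB lA dEu dsv).
rewrite (opB lA dEu dsv) (opD lA dEu dsv) (opZ lA s dv) -/v !ipE.
rewrite (self_adjoint_symmetric sA dv dEu) -/v (ip_norm hip) => h1 h2.
have n2 : `|E X u + s *: v| ^+ 2 <= 4 * `|E X u| ^+ 2.
  have : `|E X u + s *: v| <= 2 * `|E X u|.
    apply: (le_trans (ler_normD _ _)); rewrite normrZ gtr0_norm// /s divfK ?gt_eqF//.
    lra.
  move=> h; rewrite -[4](_ : 2 ^+ 2 = _) -?exprMn ?ler_sqr ?nnegrE ?mulr_ge0//.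
  by rewrite expr2; ring.
have h3 : 4 * (s * `|v| ^+ 2) <= a * (4 * `|E X u| ^+ 2).
  apply: le_trans (_ : a * `|E X u + s *: v| ^+ 2 <= _); last by rewrite ler_wpM2l.
  by move: h1 h2; lra.
have sv : s * `|v| ^+ 2 = `|E X u| * `|v| by rewrite /s expr2 mulrA divfK// gt_eqF.
rewrite sv in h3.
rewrite -(ler_pM2l nu); move: h3; rewrite expr2; nra.
Qed.

End Cutoff.
End SpectralMeasure.

(** * Location of the spectrum on the two sides of the cutoff *)

Section Gap.
Context (R : realType) (H : completeNormedModType R) (ip : {dot H for idfun}).
Hypothesis hip : induces_norm ip.
Context (A : partial_op H) (E : set R -> H -> H).
Hypothesis sA : self_adjoint ip A.
Hypothesis nnA : nonnegative_op ip A.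
Hypothesis hE : is_spectral_measure ip A E.
Context (a : R).
Hypothesis a0 : 0 <= a.
Local Notation P := (E `[0, a]%classic).

Let hP : orthogonal_projection ip P.
Proof. by apply: (spectral_proj hE); exact: measurable_itv. Qed.
Let rP : reduces P A. Proof. exact: (cutoff_reduces hip sA nnA hE). Qed.
Let lA : linear_op A. Proof. by case: sA. Qed.

Lemma beta_le : beta A P <= a.
Proof.
have ub : ubound (spectrum_on (range P) A) a.
  move=> lam; apply: contraPT; rewrite -ltNge => alam.
  apply: (coercive_not_spectrum hip sA hP rP (c := lam - a)); first by rewrite subr_gt0.
  move=> v dv Pv.
  have [->|v0] := eqVneq v 0; first by rewrite normr0 mulr0.
  have nv : 0 < `|v| by rewrite normr_gt0.
  rewrite -(ler_pM2r nv) -mulrA -expr2.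
  have := cutoff_form_le hip hE a0 Pv.
  have := ip_le hip (- (A v - lam *: v)) v.
  rewrite normrN !ipE (ip_norm hip); lra.
(* An empty spectrum makes [beta] equal to [sup set0 = 0], which is covered by [a0]. *)
have [s0|/set0P s0] := eqVneq (spectrum_on (range P) A) set0.
  by rewrite /beta s0 sup0.
exact: ge_sup.
Qed.

(** If the complement were trivial, [A] would be bounded and defined everywhere. Then
    [u = K (A u - lam *: u)] would place the unit ball in the image under the compact [K] of a ball
    of radius [a + |lam|], against infinite dimension. *)
Lemma cutoff_compl_nontrivial : infinite_dimensional H -> compact_resolvent A ->
  exists v, [/\ dom A v, compl P v = v & v != 0].
Proof.
move=> idim [lam [K [[_ K2 _] Kc]]]; apply: contrapT => no.
have [_ dA _] := sA.
have Pdom v : dom A v -> P v = v.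
  move=> dv; apply: contrapT => Pv; apply: no; exists (compl P v).
  have [dP _] := rP dv; split; first exact: domB.
    by rewrite (projK (compl_proj hP)).
  by apply/eqP => /eqP; rewrite subr_eq0 eq_sym => /eqP.
have PT v : P v = v.
  have [x_ xD xv] := dense_seq dA v.
  have c1 : P (x_ n) @[n --> \oo] --> P v.
    by apply: continuous_cvg => //; exact: (proj_continuous hip hP).
  rewrite (_ : (fun n => _) = x_) in c1; first exact: (cvg_unique _ c1 xv).
  by apply/funext => n; rewrite Pdom.
have dT v : dom A v by rewrite -(PT v); exact: (dom_cutoff hip hE).
apply: (precompact_unit_ball hip (Kc [set v | `|v| <= a + `|lam|] _) _ idim).
  by exists (a + `|lam|); split; [exact: num_real|move=> x /ltW h y /= /le_trans -> //].
move=> u /= u1; exists (A u - lam *: u) => /=; last by have [_ ->] := K2 u (dT u) Logic.I.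
apply: (le_trans (ler_normB _ _)); rewrite normrZ.
have := cutoff_op_bounded hip sA nnA hE a0 u; rewrite PT => Au.
by apply: lerD; [exact: le_trans Au (ler_piMr a0 u1)|rewrite ler_piMr].
Qed.

Lemma lambda_plus_ge : infinite_dimensional H -> compact_resolvent A ->
  a <= lambda_plus A P.
Proof.
move=> idim cr; have hQ := compl_proj hP; have rQ := compl_reduces lA rP.
have lbQ v : dom A v -> compl P v = v -> a * `|v| ^+ 2 <= ip (A v) v.
  move=> dv Qv; apply: (cutoff_compl_form_ge hip nnA hE a0 dv).
  by rewrite -Qv (compl_projK hP).
have [v [dv Qv v0]] := cutoff_compl_nontrivial idim cr.
apply: lb_le_inf; first exact: (spectrum_nonempty hip sA hQ lbQ dv Qv v0).
move=> lam; apply: contraPT; rewrite -ltNge => lama.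
apply: (coercive_not_spectrum hip sA hQ rQ (c := a - lam)); first by rewrite subr_gt0.
move=> w dw Qw; have [->|w0] := eqVneq w 0; first by rewrite normr0 mulr0.
have nw : 0 < `|w| by rewrite normr_gt0.
rewrite -(ler_pM2r nw) -mulrA -expr2.
have := lbQ _ dw Qw; have := ip_le hip (A w - lam *: w) w.
rewrite !ipE (ip_norm hip); lra.
Qed.

End Gap.

(** * Differentiation of Hilbert space valued functions *)

Section Calculus.
Context (R : realType).

Section NormedModule.
Context (V : normedModType R).
Implicit Types (f : R -> V).

(** A form without quotients, in which estimates obtained separately for [s] to the left and to the
    right of [t] can be used directly. *)
Lemma is_derive_distP f (t : R) (df : V) :
  is_derive t (1 : R) f df <->
  forall e, 0 < e -> exists2 d, 0 < d &
    forall s, `|s - t| < d -> `|f s - f t - (s - t) *: df| <= e * `|s - t|.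
Proof.
have quot h : h != 0 -> h^-1 *: (f (h *: (1 : R) + t) - f t) - df =
    h^-1 *: (f (h + t) - f t - h *: df).
  by move=> h0; rewrite [h *: _]mulr1 [RHS]scalerBr scalerA mulVf// scale1r.
split=> [[df1 dfE] e e0|h].
  have : h^-1 *: (f (h *: (1 : R) + t) - f t) @[h --> 0^'] --> df.
    by rewrite -dfE; exact: df1.
  move=> /cvgrPdist_le/(_ e e0)[d /= d0 hd].
  exists d => // s sd; have [->|st] := eqVneq s t.
    by rewrite !subrr scale0r subrr !normr0 mulr0.
  have st0 : s - t != 0 by rewrite subr_eq0.
  have := hd (s - t) _ st0; rewrite /= sub0r normrN => /(_ sd).
  rewrite distrC quot// subrK normrZ normfV mulrC ler_pdivrMr ?normr_gt0//.
have cv : h^-1 *: (f (h *: (1 : R) + t) - f t) @[h --> 0^'] --> df.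
  apply/cvgrPdist_le => e e0; have [d d0 hd] := h e e0.
  exists d => // k /=; rewrite /= sub0r normrN => kd k0.
  rewrite distrC quot// normrZ normfV mulrC ler_pdivrMr ?normr_gt0//.
  by have := hd (k + t); rewrite addrK; exact.
split; [by apply/cvg_ex; exists df|exact: cvg_lim cv].
Qed.

Lemma within_continuous_distP f (D : set R) :
  (forall t, D t -> forall e, 0 < e -> exists2 d, 0 < d &
    forall s, D s -> `|s - t| < d -> `|f s - f t| <= e) ->
  {within D, continuous f}.
Proof.
move=> h; apply/subspace_continuousP => t Dt; apply/cvgrPdist_le => e e0.
have [d d0 hd] := h t Dt e e0.
exists d => // s /=; rewrite /= => sd Ds.
by rewrite distrC; apply: hd => //; rewrite distrC.
Qed.

Lemma within_continuous_dist f (D : set R) : {within D, continuous f} ->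
  forall t, D t -> forall e, 0 < e -> exists2 d, 0 < d &
    forall s, D s -> `|s - t| < d -> `|f s - f t| <= e.
Proof.
move=> /subspace_continuousP h t Dt e e0.
have /cvgrPdist_le/(_ e e0)[d /= d0 hd] := h t Dt.
exists d => // s Ds st; rewrite distrC; apply: hd => //.
by rewrite /= distrC.
Qed.

End NormedModule.

Lemma nonincreasing_of_derive (f df : R -> R) (a b : R) : a <= b ->
  {within `[a, b], continuous f} ->
  (forall x, a < x < b -> is_derive x (1 : R) f (df x) /\ df x <= 0) ->
  f b <= f a.
Proof.
move=> ab cf h; apply: (@ler0_derive1_le_cc _ f a b) => //.
- by move=> x; rewrite in_itv/= => /h[[]].
- by move=> x; rewrite in_itv/= => /h[[_ e] le0]; rewrite derive1E e.
- by rewrite in_itv/= ab lexx.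
- by rewrite in_itv/= ab lexx.
Qed.

Lemma constant_of_derive0 (f : R -> R) (a b : R) : a <= b ->
  {within `[a, b], continuous f} ->
  (forall x, a < x < b -> is_derive x (1 : R) f 0) -> f b = f a.
Proof.
move=> ab cf h; have [c _ e] := @MVT_segment _ f (cst 0) _ _ ab
  (fun x => h x) cf.
by apply/eqP; rewrite -subr_eq0 e mul0r.
Qed.

Section InnerProduct.
Context (H : completeNormedModType R) (ip : {dot H for idfun}).
Hypothesis hip : induces_norm ip.

Lemma is_derive_ip (f g : R -> H) (t : R) (df dg : H) :
  is_derive t (1 : R) f df -> is_derive t (1 : R) g dg ->
  is_derive t (1 : R) (fun s => ip (f s) (g s)) (ip df (g t) + ip (f t) dg).
Proof.
move=> hf hg; have [f1 f2] := hf; have [g1 g2] := hg.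
have cg : g (h *: (1 : R) + t) @[h --> 0^'] --> g t.
  have : {for t, continuous g} by apply: differentiable_continuous; exact/derivable1_diffP.
  have l : h *: (1 : R) + t @[h --> 0^'] --> t.
    apply/cvgrPdist_le => e e0; exists e => // k /=; rewrite sub0r normrN => ke _.
    by rewrite [k *: _]mulr1 opprD addrCA subrr addr0 normrN ltW.
  by move=> cg; exact: (cvg_comp _ _ l cg).
have cv : h^-1 *: (ip (f (h *: (1 : R) + t)) (g (h *: (1 : R) + t)) - ip (f t) (g t))
    @[h --> 0^'] --> ip df (g t) + ip (f t) dg.
  rewrite (_ : (fun h => _) = (fun h =>
    ip (h^-1 *: (f (h *: (1 : R) + t) - f t)) (g (h *: (1 : R) + t)) +
    ip (f t) (h^-1 *: (g (h *: (1 : R) + t) - g t)))); last first.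
    by apply/funext => h; rewrite !ipE [_ *: _]mulrBr; ring.
  apply: cvgD; apply: (cvg_ip hip) => //.
  - by rewrite -f2; exact: f1.
  - exact: cvg_cst.
  - by rewrite -g2; exact: g1.
split; [by apply/cvg_ex; eexists; exact: cv|exact: cvg_lim cv].
Qed.

Lemma within_continuous_ip (f g : R -> H) (D : set R) :
  {within D, continuous f} -> {within D, continuous g} ->
  {within D, continuous (fun s => ip (f s) (g s))}.
Proof. by move=> cf cg x; apply: (cvg_ip hip); [exact: cf|exact: cg]. Qed.

Lemma within_continuous_proj (P : H -> H) (f : R -> H) (D : set R) :
  orthogonal_projection ip P -> {within D, continuous f} ->
  {within D, continuous (P \o f)}.
Proof.
move=> hP cf; apply: within_continuous_distP => t Dt e e0.
have [d d0 hd] := within_continuous_dist cf Dt e0; exists d => // s Ds st.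
by rewrite /= -(projB hP); apply: le_trans (norm_proj hip hP _) _; exact: hd.
Qed.

Lemma is_derive_proj (P : H -> H) (f : R -> H) (t : R) (df : H) :
  orthogonal_projection ip P -> is_derive t (1 : R) f df ->
  is_derive t (1 : R) (P \o f) (P df).
Proof.
move=> hP /is_derive_distP h; apply/is_derive_distP => e e0.
have [d d0 hd] := h e e0; exists d => // s sd.
rewrite /= -(projB hP) -(projZ hP) -(projB hP).
by apply: le_trans (norm_proj hip hP _) _; exact: hd.
Qed.

End InnerProduct.

Lemma is_derive_rev (V : normedModType R) (f : R -> V) (t r : R) (df : V) :
  is_derive (r - t) (1 : R) f df ->
  is_derive t (1 : R) (fun s => f (r - s)) (- df).
Proof.
move=> /is_derive_distP h; apply/is_derive_distP => e e0.
have [d d0 hd] := h e e0; exists d => // s sd.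
have -> : `|s - t| = `|r - s - (r - t)| by rewrite distrC; congr `|_|; ring.
have -> : (s - t) *: - df = (r - s - (r - t)) *: df.
  by rewrite scalerN -scaleNr; congr (_ *: _); ring.
by apply: hd; rewrite (_ : _ - _ = t - s) 1?distrC//; ring.
Qed.

End Calculus.

(** * The semigroup of a nonnegative symmetric operator *)

Section Semigroup.
Context (R : realType) (H : completeNormedModType R) (ip : {dot H for idfun}).
Hypothesis hip : induces_norm ip.
Context (A : partial_op H) (T : R -> H -> H).
Implicit Types (s t a e : R) (u v : H).
Hypothesis dA : dense (dom A).
Hypothesis symA : symmetric_op ip A.
Hypothesis nnA : nonnegative_op ip A.
Hypothesis hT : is_semigroup_of A T.

Lemma semigroupB t u v : 0 <= t -> T t (u - v) = T t u - T t v.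
Proof.
case: hT => h1 _ _ _ _ t0; have [l _] := h1 t t0.
by rewrite addrC -scaleN1r l scaleN1r addrC.
Qed.

Lemma semigroupZ t a u : 0 <= t -> T t (a *: u) = a *: T t u.
Proof.
case: hT => h1 _ _ _ _ t0; have [l _] := h1 t t0.
have T0 : T t 0 = 0.
  by have := l (-1) 0 0; rewrite scaler0 addr0 scaleN1r addNr.
by have := l a u 0; rewrite T0 !addr0.
Qed.

Lemma semigroupN t u : 0 <= t -> T t (- u) = - T t u.
Proof. by move=> t0; rewrite -scaleN1r semigroupZ// scaleN1r. Qed.

Lemma semigroup0 u : T 0 u = u.
Proof. by case: hT. Qed.

Lemma semigroupD s t u : 0 <= s -> 0 <= t -> T (s + t) u = T s (T t u).
Proof. by case: hT => _ _ h _ _ s0 t0; exact: h. Qed.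

Lemma semigroup_continuous t : 0 <= t -> continuous (T t).
Proof. by case: hT => h _ _ _ _ /h[]. Qed.

Lemma semigroup_dom t u : 0 <= t -> dom A u ->
  dom A (T t u) /\ A (T t u) = T t (A u).
Proof.
case: hT => h1 h2 h3 h4 gen t0 du; apply/gen.
have := (gen u (A u)).1 (conj du erefl) => c.
have c' := cvg_comp _ _ c (semigroup_continuous t0 (x := A u)).
apply: cvg_trans c'; apply: near_eq_cvg.
near=> h; have h0 : 0 <= h by near: h; exact: nbhs_right_ge.
by rewrite /= semigroupZ// semigroupB// -!semigroupD// (addrC t).
Unshelve. all: end_near. Qed.

Lemma semigroup_strong u e : 0 < e ->
  exists2 d, 0 < d & forall h, 0 <= h < d -> `|T h u - u| <= e.
Proof.
case: hT => _ _ _ /(_ u) /cvgrPdist_le h4 _ e0.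
have [d /= d0 hd] := h4 e e0; exists d => // h /andP[h0 hd1].
have [->|hn] := eqVneq h 0; first by rewrite semigroup0 subrr normr0 ltW.
rewrite distrC; apply: hd; last by rewrite lt_neqAle eq_sym hn h0.
by rewrite /= sub0r normrN ger0_norm.
Qed.

Lemma semigroup_generator u e : dom A u -> 0 < e ->
  exists2 d, 0 < d & forall h, 0 <= h < d -> `|T h u - u + h *: A u| <= e * h.
Proof.
case: hT => _ _ _ _ gen du e0.
have /cvgrPdist_le h4 := (gen u (A u)).1 (conj du erefl).
have [d /= d0 hd] := h4 e e0; exists d => // h /andP[h0 hd1].
have [->|hn] := eqVneq h 0.
  by rewrite semigroup0 subrr scale0r addr0 normr0 mulr0.
have hp : 0 < h by rewrite lt_neqAle eq_sym hn h0.
have := hd h; rewrite /= sub0r normrN ger0_norm// => /(_ hd1 hp).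
have -> : A u - h^-1 *: (u - T h u) = h^-1 *: (T h u - u + h *: A u).
  by apply: (ip_inj hip) => z; rewrite !ipE; field.
by rewrite normrZ normfV ger0_norm// mulrC ler_pdivrMr.
Qed.

(** Each [T t] is bounded, but not a priori uniformly near 0. If uniformity failed there would be
    times [t_n] tending to 0 with the norm of [T t_n] above [n + 1]; strong continuity makes these
    operators pointwise bounded, contrary to Banach-Steinhaus. *)
Lemma semigroup_locally_bounded :
  exists C d : R, [/\ 0 <= C, 0 < d & forall t u, 0 <= t <= d -> `|T t u| <= C * `|u|].
Proof.
apply: contrapT => no.
have /choice[p hp] (n : nat) : exists p : R * H,
    0 <= p.1 <= n.+1%:R^-1 /\ n.+1%:R * `|p.2| < `|T p.1 p.2|.
  apply: contrapT => h; apply: no; exists n.+1%:R, n.+1%:R^-1.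
  split=> // t u tn; rewrite leNgt; apply/negP => lt.
  by apply: h; exists (t, u).
have [h1 _ _ _ _] := hT.
pose F := [set f : H -> H | exists n, f = T (p n).1].
have Fbnd f : F f -> bounded_fun_norm f /\ linear f.
  move=> [n ->]; have [/andP[t0 _] _] := hp n.
  have [l c] := h1 _ t0; split=> //.
  pose g : {linear H -> H} := HB.pack (T (p n).1) (GRing.isLinear.Build _ _ _ _ _ l).
  have : continuous g := c.
  move=> /linear_bounded_continuous/linear_boundedP/pinfty_ex_gt0[M M0 hM] r.
  by exists (M * r) => x xr; apply: le_trans (hM x) _; rewrite ler_pM2l.
have Fpt : pointwise_bounded F.
  move=> u.
  have cv : T (p n).1 u @[n --> \oo] --> u.
    apply/cvgrPdist_le => e e0; have [d d0 hd] := semigroup_strong u e0.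
    near=> n; have [/andP[t0 tn] _] := hp n; rewrite distrC; apply: hd.
    rewrite t0 (le_lt_trans tn)//; near: n.
    exact: (near_infty_natSinv_lt (PosNum d0)).
  have [M [_ MP]] := cvg_seq_bounded (cvgP _ cv).
  exists (M + 1) => f [n ->]; by apply: (MP (M + 1)) => //; rewrite ltrDl.
have [M hM] := Banach_Steinhauss Fbnd Fpt 1.
have [/andP[t0 _] lt] := hp (Num.truncn `|M|).
set n := Num.truncn _ in t0 lt; set u := (p n).2 in lt; set t := (p n).1 in t0 lt.
have u0 : 0 < `|u|.
  rewrite normr_gt0; apply: contraTneq lt => ->.
  by rewrite normr0 mulr0 -[0 : H](scale0r 0) semigroupZ// scale0r normr0 ltxx.
have := hM (T t) (ex_intro _ n erefl) (`|u|^-1 *: u).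
rewrite normrZ normfV normr_id mulVf ?gt_eqF// => /(_ (lexx _)).
rewrite semigroupZ// normrZ normfV normr_id mulrC ler_pdivrMr// => le.
have := lt_le_trans lt le; rewrite ltr_pM2r// ltNge => /negP; apply.
by rewrite (le_trans (ler_norm _))// ltW// /n truncnS_gt.
Unshelve. all: end_near. Qed.

Section LocalBound.
Context (C d : R).
Hypothesis C0 : 0 <= C.
Hypothesis bnd : forall t u, 0 <= t <= d -> `|T t u| <= C * `|u|.

(** Factoring out the semigroup at the smaller time leaves strong continuity at 0. This section is
    used twice: with the Banach-Steinhaus bound, in order to prove contraction, and then with
    [C = 1] and arbitrary [d]. *)
Lemma semigroup_dist s t u : 0 <= s <= d -> 0 <= t <= d ->
  `|T s u - T t u| <= C * `|T (`|s - t|) u - u|.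
Proof.
wlog st : s t / t <= s.
  move=> h sd td; have [ts|/ltW st] := leP t s; first exact: h.
  by rewrite distrC (distrC s); exact: h.
move=> sd td; rewrite ger0_norm ?subr_ge0//.
have [t0 _] := andP td; have st0 : 0 <= s - t by rewrite subr_ge0.
by rewrite -[in T s](subrKC t s) (semigroupD u t0 st0) -semigroupB// bnd.
Qed.

Lemma semigroup_within_continuous u : {within `[0, d], continuous (T^~ u)}.
Proof.
apply: within_continuous_distP => t /=; rewrite in_itv/= => td e e0.
have e1 : 0 < e / (C + 1) by rewrite divr_gt0// ltr_wpDl.
have [k k0 hk] := semigroup_strong u e1; exists k => // s.
rewrite /= in_itv/= => sd st; apply: le_trans (semigroup_dist u sd td) _.
have := hk `|s - t|; rewrite normr_ge0 st => /(_ isT).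
rewrite ler_pdivlMr ?ltr_wpDl// mulrC; apply: le_trans.
by rewrite ler_wpM2r// lerDl.
Qed.

(** The generator gives an expansion forward in time only. For [s < t] it is taken from [s], and the
    resulting [T s (A u)] is replaced by [T t (A u)] by continuity of that orbit; the two errors
    account for the halves of [e]. *)
Lemma semigroup_is_derive u t : dom A u -> 0 < t < d ->
  is_derive t (1 : R) (T^~ u) (- T t (A u)).
Proof.
move=> du /andP[t0 td]; apply/is_derive_distP => e e0.
have e1 : 0 < e / (2 * (C + 1)) by rewrite divr_gt0// mulr_gt0// ltr_wpDl.
have [k1 k10 hk1] := semigroup_generator du e1.
have tm : 0 <= t <= d by rewrite !ltW.
have cA : {within `[0, d], continuous (T^~ (A u))} by exact: semigroup_within_continuous.
have [||k2 k20 hk2] := within_continuous_dist cA (t := t) _ (e := e / 2) _.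
- by rewrite /= in_itv.
- by rewrite divr_gt0.
exists (Num.min (Num.min k1 k2) (Num.min t (d - t))).
  by rewrite !lt_min k10 k20 t0 subr_gt0.
move=> s; rewrite !lt_min => /andP[/andP[sk1 sk2] /andP[st sdt]].
have sm : 0 <= s <= d.
  by move: st sdt; rewrite !ltr_norml => /andP[? ?] /andP[? ?]; apply/andP; split; lra.
have hsc : 0 <= (C + 1) by rewrite ltW// ltr_wpDl.
have step r q : 0 <= r <= d -> 0 <= q <= d -> r <= q -> q - r < k1 ->
    `|T q u - T r u + (q - r) *: T r (A u)| <= e / 2 * (q - r).
  move=> /andP[r0 rd] _ rq qr.
  have qr0 : 0 <= q - r by rewrite subr_ge0.
  rewrite -[in T q](subrKC r q) (semigroupD u r0 qr0).
  rewrite -semigroupZ// -semigroupB// -[X in _ + X]opprK -semigroupN// -semigroupB// opprK.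
  apply: le_trans (bnd _ _) _; first by rewrite r0.
  have := hk1 (q - r); rewrite subr_ge0 rq qr => /(_ isT) h.
  apply: (@le_trans _ _ ((C + 1) * (e / (2 * (C + 1)) * (q - r)))).
    by apply: ler_pM => //; rewrite lerDl.
  rewrite [leLHS](_ : _ = e / 2 * (q - r))//.
  by field; rewrite gt_eqF// ltr_wpDl.
have [ts|st'] := leP t s.
  rewrite scalerN opprK ger0_norm ?subr_ge0//.
  apply: le_trans (step t s tm sm ts _) _; first by rewrite ger0_norm ?subr_ge0 in sk1.
  by rewrite ler_wpM2r ?subr_ge0//; lra.
rewrite ltr0_norm ?subr_lt0// opprB.
rewrite ltr0_norm ?subr_lt0// opprB in sk1.
have h1 := step s t sm tm (ltW st') sk1.
have h2 : `|(t - s) *: (T s (A u) - T t (A u))| <= e / 2 * (t - s).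
  rewrite normrZ gtr0_norm ?subr_gt0// mulrC ler_pM2r ?subr_gt0//.
  by apply: hk2 => /=; rewrite ?in_itv.
rewrite (_ : _ - _ = - (T t u - T s u + (t - s) *: T s (A u)) +
   (t - s) *: (T s (A u) - T t (A u))); last first.
  by apply: (ip_inj hip) => z; rewrite !ipE; ring.
by apply: le_trans (ler_normD _ _) _; rewrite normrN; move: h1 h2; lra.
Qed.

Lemma semigroup_energy_decay u t a : dom A u -> 0 <= t <= d ->
  (forall s, 0 <= s <= t -> a * `|T s u| ^+ 2 <= ip (A (T s u)) (T s u)) ->
  expR (a * t) * `|T t u| <= `|u|.
Proof.
move=> du /andP[t0 td] low.
have sub : `[0, t] `<=` `[0, d].
  by move=> x /=; rewrite !in_itv/= => /andP[-> /le_trans ->].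
pose g s := ip (T s u) (T s u).
pose f s := expR (2 * a * s) * g s.
have cf : {within `[0, t], continuous f}.
  move=> x; apply: cvgM.
    apply: continuous_subspaceT => y; apply: continuous_comp; last exact: continuous_expR.
    by apply: cvgMr; exact: cvg_id.
  apply: (within_continuous_ip hip); apply: (continuous_subspaceW sub);
    exact: semigroup_within_continuous.
have df s : 0 < s < t -> is_derive s (1 : R) f
    (expR (2 * a * s) * (2 * (a * g s - ip (A (T s u)) (T s u)))).
  move=> /andP[s0 st]; have sd : 0 < s < d by rewrite s0 (lt_le_trans st).
  have := is_derive_ip hip (semigroup_is_derive du sd) (semigroup_is_derive du sd).
  have [_ <-] := semigroup_dom (ltW s0) du.
  move=> dg.
  apply: is_derive_eq.
  rewrite !ipE (ipC ip (T s u) (A _)) /g /GRing.scale/=; ring.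
have : f t <= f 0.
  apply: (nonincreasing_of_derive t0 cf) => s hs; split; first exact: df.
  have /andP[s0 st] := hs.
  rewrite pmulr_rle0 ?expR_gt0// pmulr_rle0// subr_le0 /g (ip_norm hip).
  by apply: low; rewrite !ltW.
rewrite /f /g mulr0 expR0 mul1r semigroup0 !(ip_norm hip) => le.
rewrite -(@ler_pXn2r _ 2) ?nnegrE ?mulr_ge0 ?expR_ge0// exprMn -expRM_natl mulrA.
exact: le.
Qed.

End LocalBound.

Lemma semigroup_contraction t u : 0 <= t -> `|T t u| <= `|u|.
Proof.
have [C [d [C0 d0 bnd]]] := semigroup_locally_bounded.
have loc s v : 0 <= s <= d -> `|T s v| <= `|v|.
  move=> sd; have s0 : 0 <= s by case/andP: sd.
  have [x_ xD xv] := dense_seq dA v.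
  have c1 : `|T s (x_ n)| @[n --> \oo] --> `|T s v|.
    by apply: cvg_norm; apply: continuous_cvg => //; exact: semigroup_continuous.
  have c2 : `|x_ n| @[n --> \oo] --> `|v| by exact: cvg_norm.
  rewrite -(cvg_lim _ c1)// -(cvg_lim _ c2)//.
  apply: ler_lim; [exact: cvgP c1|exact: cvgP c2|].
  near=> n; have := semigroup_energy_decay C0 bnd (a := 0) (xD n) sd.
  rewrite mul0r expR0 mul1r; apply=> r /andP[r0 _]; rewrite mul0r.
  by apply: nnA; have [] := semigroup_dom r0 (xD n).
move=> t0; pose n := (Num.truncn (t / d)).+1.
have hn : 0 <= t / n%:R <= d.
  rewrite divr_ge0//= ler_pdivrMr ?ltr0n// mulrC -ler_pdivrMr//.
  by rewrite ltW// truncnS_gt.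
have [h0 _] := andP hn.
have it k : `|T (k%:R * (t / n%:R)) u| <= `|u|.
  elim: k => [|k IHk]; first by rewrite mul0r semigroup0.
  rewrite -natr1 mulrDl mul1r addrC semigroupD ?mulr_ge0//.
  exact: le_trans (loc _ _ hn) IHk.
by have := it n; rewrite mulrC divfK// pnatr_eq0.
Unshelve. all: end_near. Qed.

Let bnd1 d t u : 0 <= t <= d -> `|T t u| <= 1 * `|u|.
Proof. by move=> /andP[t0 _]; rewrite mul1r; exact: semigroup_contraction. Qed.

Lemma semigroup_orbit_continuous d u : {within `[0, d], continuous (T^~ u)}.
Proof. exact: semigroup_within_continuous ler01 (@bnd1 d) u. Qed.

Lemma semigroup_derive u t : dom A u -> 0 < t ->
  is_derive t (1 : R) (T^~ u) (- T t (A u)).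
Proof.
move=> du t0; apply: (semigroup_is_derive ler01 (@bnd1 (t + 1)) du).
by rewrite t0/= ltrDl.
Qed.

(** For vectors in the domain, [s |-> ip (P (T s x)) (T (t - s) y)] has zero derivative because [A]
    is symmetric and commutes with [P]. Its endpoint values are the two sides. The case [P = id] is
    symmetry of the semigroup, and the two cases together give commutation. *)
Lemma semigroup_commute_symmetric (P : H -> H) t u w :
  orthogonal_projection ip P -> reduces P A -> 0 <= t ->
  ip (P (T t u)) w = ip (P u) (T t w).
Proof.
move=> hP rP t0.
have core x y : dom A x -> dom A y -> ip (P (T t x)) y = ip (P x) (T t y).
  move=> dx dy.
  pose k s := ip (P (T s x)) (T (t - s) y).
  have ck : {within `[0, t], continuous k}.
    have cx : {within `[0, t], continuous (T^~ x)} by exact: semigroup_orbit_continuous.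
    have cy : {within `[0, t], continuous (T^~ y)} by exact: semigroup_orbit_continuous.
    apply: (within_continuous_ip hip).
      exact: (within_continuous_proj hip hP cx).
    apply: within_continuous_distP => s /=; rewrite in_itv/= => /andP[s0 st] e e0.
    have [||d d0 hd] := within_continuous_dist cy (t := t - s) _ (e := e) _ => //.
      by rewrite /= in_itv/= subr_ge0 st lerBlDr lerDl s0.
    exists d => // r; rewrite /= in_itv/= => /andP[r0 rt] rs; apply: hd.
      by rewrite /= in_itv/= subr_ge0 rt lerBlDr lerDl r0.
    by rewrite (_ : _ - _ = s - r) 1?distrC//; ring.
  have := constant_of_derive0 t0 ck; rewrite /k subrr subr0 !semigroup0; apply.
  move=> s /andP[s0 st].
  have d1 := is_derive_proj hip hP (semigroup_derive dx s0).
  have ts0 : 0 < t - s by rewrite subr_gt0.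
  have d2 := is_derive_rev (semigroup_derive dy ts0).
  have d3 := is_derive_ip hip d1 d2.
  apply: is_derive_eq; rewrite opprK (projN hP) ipNl.
  have [dTx <-] := semigroup_dom (ltW s0) dx.
  have [dTy <-] := semigroup_dom (ltW ts0) dy.
  have [dPT <-] := rP _ dTx.
  by rewrite symA// addNr.
have [x_ xD xu] := dense_seq dA u; have [y_ yD yw] := dense_seq dA w.
have cP := proj_continuous hip hP; have cT := semigroup_continuous t0.
have c1 : ip (P (T t (x_ n))) (y_ n) @[n --> \oo] --> ip (P (T t u)) w.
  apply: (cvg_ip hip) => //; apply: continuous_cvg; first exact: cP.
  by apply: continuous_cvg => //; exact: cT.
have c2 : ip (P (x_ n)) (T t (y_ n)) @[n --> \oo] --> ip (P u) (T t w).
  by apply: (cvg_ip hip); apply: continuous_cvg => //; [exact: cP|exact: cT].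
rewrite (_ : (fun n => _) = (fun n => ip (P (x_ n)) (T t (y_ n)))) in c1.
  exact: (cvg_unique _ c1 c2).
by apply/funext => n; exact: core.
Qed.

Lemma semigroup_symmetric t u w : 0 <= t -> ip (T t u) w = ip u (T t w).
Proof.
by move=> t0; apply: (semigroup_commute_symmetric (P := id)).
Qed.

Lemma semigroup_commute (P : H -> H) t u :
  orthogonal_projection ip P -> reduces P A -> 0 <= t -> P (T t u) = T t (P u).
Proof.
move=> hP rP t0; apply: (ip_inj hip) => w.
by rewrite (semigroup_commute_symmetric u w hP rP t0) -semigroup_symmetric.
Qed.

Lemma semigroup_decay (P : H -> H) a t u :
  orthogonal_projection ip P -> reduces P A ->
  (forall v, dom A v -> P v = v -> a * `|v| ^+ 2 <= ip (A v) v) ->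
  0 <= t -> expR (a * t) * `|T t (P u)| <= `|P u|.
Proof.
move=> hP rP low t0.
have [x_ xD xu] := dense_seq dA u.
have cP : P (x_ n) @[n --> \oo] --> P u.
  by apply: continuous_cvg => //; exact: (proj_continuous hip hP).
have c1 : expR (a * t) * `|T t (P (x_ n))| @[n --> \oo] --> expR (a * t) * `|T t (P u)|.
  apply: cvgMr; apply: cvg_norm; apply: continuous_cvg => //.
  exact: semigroup_continuous.
have c2 : `|P (x_ n)| @[n --> \oo] --> `|P u| by exact: cvg_norm.
rewrite -(cvg_lim _ c1)// -(cvg_lim _ c2)//.
apply: ler_lim; [exact: cvgP c1|exact: cvgP c2|].
near=> n; have [dP _] := rP _ (xD n).
apply: (semigroup_energy_decay ler01 (@bnd1 t) dP); first by rewrite t0 lexx.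
move=> s /andP[s0 _]; apply: low; first by have [] := semigroup_dom s0 dP.
by rewrite semigroup_commute// (projK hP).
Unshelve. all: end_near. Qed.

End Semigroup.

(** * Mild solutions *)

Section ScalarIntegral.
Context (R : realType).
Local Notation mu := (@lebesgue_measure R).
Implicit Types (a b t C : R) (f g : R -> R).

Lemma Rintegral_itv_cst a b C : a <= b -> \int[mu]_(s in `[a, b]) C = C * (b - a).
Proof.
move=> ab; rewrite Rintegral_cst//; congr (_ * _).
have := @lebesgue_measure_itv R `[a, b]; rewrite /= => ->.
rewrite lte_fin; case: ltP => [_|ba]; first by rewrite -EFinB.
by rewrite (le_anti (introT andP (conj ab ba))) subrr.
Qed.

Lemma integrable_itv_cst a b C : mu.-integrable `[a, b] (EFin \o (fun=> C)).
Proof.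
apply: continuous_compact_integrable; first exact: segment_compact.
by apply: continuous_subspaceT => x; exact: cvg_cst.
Qed.

Lemma Rintegral_itv_le a b f g : mu.-integrable `[a, b] (EFin \o f) ->
  mu.-integrable `[a, b] (EFin \o g) ->
  (forall s, a <= s <= b -> `|f s| <= g s) ->
  `|\int[mu]_(s in `[a, b]) f s| <= \int[mu]_(s in `[a, b]) g s.
Proof.
move=> fi gi fg; apply: (le_trans (le_normr_Rintegral _ fi)) => //.
by apply: le_Rintegral => //; exact: (integrable_norm fi).
Qed.

Lemma integrable_expR_decay a t :
  mu.-integrable `[0, t] (EFin \o (fun s => expR (- (a * (t - s))))).
Proof.
apply: continuous_compact_integrable; first exact: segment_compact.
apply: continuous_subspaceT => x.
apply: continuous_comp; last exact: continuous_expR.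
by apply: cvgN; apply: cvgMr; apply: cvgB; [exact: cvg_cst|exact: cvg_id].
Qed.

Lemma Rintegral_expR_decay a t : 0 < a -> 0 <= t ->
  \int[mu]_(s in `[0, t]) expR (- (a * (t - s))) <= a^-1.
Proof.
move=> a0; rewrite le_eqVlt => /predU1P[<-|t0].
  by rewrite set_itv1 Rintegral_set1 invr_ge0 ltW.
pose f s := expR (- (a * (t - s))); pose G s := a^-1 * f s.
have dG s : is_derive s (1 : R) G (f s).
  apply: is_derive_eq; rewrite /f /GRing.scale/=.
  by field; rewrite gt_eqF.
have cG : continuous G.
  by move=> s; apply: differentiable_continuous; apply/derivable1_diffP; case: (dG s).
rewrite /Rintegral (@continuous_FTC2 _ f G)//.
- rewrite -EFinB/= /G /f subrr mulr0 oppr0 expR0 mulr1 gerBl.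
  by rewrite mulr_ge0 ?invr_ge0 ?ltW ?expR_gt0.
- apply: continuous_subspaceT => x.
  apply: continuous_comp; last exact: continuous_expR.
  by apply: cvgN; apply: cvgMr; apply: cvgB; [exact: cvg_cst|exact: cvg_id].
- split.
  + by move=> s _; case: (dG s).
  + exact: cvg_at_right_filter (cG 0).
  + exact: cvg_at_left_filter (cG t).
- by move=> s _; rewrite derive1E; case: (dG s).
Qed.

End ScalarIntegral.

Section WeakIntegral.
Context (R : realType) (H : completeNormedModType R) (ip : {dot H for idfun}).
Hypothesis hip : induces_norm ip.
Local Notation mu := (@lebesgue_measure R).

Lemma is_integral_dist (P : H -> H) (a b C : R) (f : R -> H) (I c : H) :
  orthogonal_projection ip P -> a <= b -> 0 <= C -> is_integral ip a b f I ->
  (forall s, a <= s <= b -> `|P (f s) - c| <= C) ->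
  `|P I - (b - a) *: c| <= C * (b - a).
Proof.
move=> hP ab C0 hI bnd; apply: (norm_le_ip hip); first by rewrite mulr_ge0// subr_ge0.
move=> w; have [fi Iw] := hI (P w).
rewrite ipBl (ip_proj hP) Iw ipZl [_ * ip c w]mulrC -(Rintegral_itv_cst (ip c w) ab).
rewrite -RintegralB//; last exact: integrable_itv_cst.
rewrite mulrAC -Rintegral_itv_cst//; apply: Rintegral_itv_le.
- exact: (integrableB _ fi (integrable_itv_cst _ _ _)).
- exact: integrable_itv_cst.
- move=> s /bnd le; rewrite -(ip_proj hP) -ipBl.
  by apply: le_trans (cauchy_schwarz hip _ _) _; rewrite ler_wpM2r.
Qed.

Lemma is_integral_le (a b : R) (f : R -> H) (g : R -> R) (I : H) :
  mu.-integrable `[a, b] (EFin \o g) -> is_integral ip a b f I ->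
  (forall s, a <= s <= b -> `|f s| <= g s) ->
  `|I| <= \int[mu]_(s in `[a, b]) g s.
Proof.
move=> gi hI bnd; apply: (norm_le_ip hip).
  apply: Rintegral_ge0 => s /=; rewrite in_itv/= => /bnd; exact: le_trans.
move=> w; have [fi ->] := hI w.
rewrite -RintegralZr//; apply: Rintegral_itv_le => //.
- rewrite (_ : _ \o _ = (fun s => (g s)%:E * `|w|%:E)%E); first exact: integrableZr.
  by apply/funext => s; rewrite /= EFinM.
- move=> s /bnd le; apply: le_trans (cauchy_schwarz hip _ _) _.
  by rewrite ler_wpM2r.
Qed.

Lemma is_integral_proj (P : H -> H) (a b : R) (f : R -> H) (I : H) :
  orthogonal_projection ip P -> is_integral ip a b f I ->
  is_integral ip a b (P \o f) (P I).
Proof.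
move=> hP hI w; have [fi Iw] := hI (P w); split.
  rewrite (_ : (fun s => (ip ((P \o f) s) w)%:E) = (fun s => (ip (f s) (P w))%:E))//.
  by apply/funext => s; rewrite /= (ip_proj hP).
by rewrite (ip_proj hP) Iw; apply: eq_Rintegral => s _; rewrite /= (ip_proj hP).
Qed.

End WeakIntegral.

Section MildSolution.
Context (R : realType) (H : completeNormedModType R) (ip : {dot H for idfun}).
Hypothesis hip : induces_norm ip.
Context (A : partial_op H) (T : R -> H -> H).
Implicit Types (s t r e a : R) (v w : H).
Hypothesis lA : linear_op A.
Hypothesis dA : dense (dom A).
Hypothesis symA : symmetric_op ip A.
Hypothesis nnA : nonnegative_op ip A.
Hypothesis hT : is_semigroup_of A T.
Context (F : H -> H) (M L : R).
Hypothesis hM : 0 < M.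
Hypothesis hL : 0 < L.
Hypothesis hFM : forall v, `|F v| <= M.
Hypothesis hFL : forall v w, `|F v - F w| <= L * `|v - w|.
Context (u : R -> H) (u0 : H).
Hypothesis cu : {within `[0, +oo[, continuous u}.
Hypothesis mild : forall t, 0 <= t ->
  is_integral ip 0 t (fun s => T (t - s) (F (u s))) (u t - T t u0).
Context (P : H -> H).
Hypothesis hP : orthogonal_projection ip P.
Hypothesis rP : reduces P A.

Lemma mild_initial : u 0 = u0.
Proof.
apply: (ip_inj hip) => w; have [_] := mild (lexx 0) w.
rewrite set_itv1 Rintegral_set1 (semigroup0 hT) ipBl => /eqP.
by rewrite subr_eq0 => /eqP.
Qed.

(** Used for the complement of the cutoff. In the Duhamel formula the free part decays at rate [a],
    and a forcing bounded by [M] contributes at most [M] times the integral of the exponential, that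
    is [M / a]. *)
Lemma mild_decay a t : 0 < a ->
  (forall v, dom A v -> P v = v -> a * `|v| ^+ 2 <= ip (A v) v) ->
  0 <= t -> `|P (u t)| <= expR (- (a * t)) * `|u0| + M / a.
Proof.
move=> a0 low t0.
have decay s v : 0 <= s -> `|P (T s v)| <= expR (- (a * s)) * `|v|.
  move=> s0; rewrite (semigroup_commute hip dA symA nnA hT) //.
  have := semigroup_decay hip dA symA nnA hT v hP rP low s0.
  rewrite expRN mulrC -ler_pdivlMr ?expR_gt0// => /le_trans; apply.
  by rewrite mulrC ler_wpM2l ?invr_ge0 ?expR_ge0// (norm_proj hip hP).
have -> : P (u t) = P (T t u0) + P (u t - T t u0).
  by rewrite -(projD hP) addrC subrK.
apply: (le_trans (ler_normD _ _)); apply: lerD; first exact: decay.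
have hI := is_integral_proj hP (mild t0).
have gi : (@lebesgue_measure R).-integrable `[0, t]
    (EFin \o (fun s => expR (- (a * (t - s))) * M)).
  rewrite (_ : _ \o _ = (fun s => (expR (- (a * (t - s))))%:E * M%:E)%E).
    by apply: integrableZr => //; exact: integrable_expR_decay.
  by apply/funext => s; rewrite /= EFinM.
apply: (le_trans (is_integral_le hip gi hI _)).
  move=> s /andP[s0 st] /=; apply: (le_trans (decay _ _ _)); first by rewrite subr_ge0.
  by rewrite ler_wpM2l ?expR_ge0.
rewrite RintegralZr//; last exact: integrable_expR_decay.
by rewrite mulrC ler_wpM2l ?(ltW hM)// Rintegral_expR_decay.
Qed.

(** Apply [T (t - s)] to the formula at time [s] and subtract it from the formula at time [t]. As
    the integral is weak, [T (t - s)] is moved under it through symmetry, by acting on the test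
    vector. *)
Lemma mild_shift s t : 0 <= s -> s <= t ->
  is_integral ip s t (fun r => T (t - r) (F (u r))) (u t - T (t - s) (u s)).
Proof.
move=> s0 st w; have t0 := le_trans s0 st; have ts0 : 0 <= t - s by rewrite subr_ge0.
have [ti tE] := mild t0 w; have [si sE] := mild s0 (T (t - s) w).
have sub : `[s, t] `<=` `[0, t].
  by move=> x /=; rewrite !in_itv/= => /andP[sx ->]; rewrite (le_trans s0).
split; first by apply: integrableS ti.
have e : u t - T (t - s) (u s) = (u t - T t u0) - (T (t - s) (u s - T s u0)).
  rewrite (semigroupB hT)// -(semigroupD hT)// subrK.
  by apply: (ip_inj hip) => z; rewrite !ipE; ring.
rewrite e ipBl tE (semigroup_symmetric hip dA symA nnA hT)// sE.
rewrite -[RHS]Rintegral_itv_obnd_cbnd; last first.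
  apply: integrableS ti => // x /=; rewrite !in_itv/= => /andP[sx ->].
  by rewrite (le_trans s0 (ltW sx)).
rewrite -(@Rintegral_itvB _ _ (BLeft 0) (BRight t) s)//; congr (_ - _).
apply: eq_Rintegral => r; rewrite inE/= in_itv/= => /andP[r0 rs].
have sr0 : 0 <= s - r by rewrite subr_ge0.
rewrite -(semigroup_symmetric hip dA symA nnA hT)// -(semigroupD hT)//.
by congr (ip (T _ _) w); ring.
Qed.

Context (a : R).
Hypothesis a0 : 0 <= a.
Hypothesis domP : forall v, dom A (P v).
Hypothesis bndP : forall v, `|A (P v)| <= a * `|v|.

Lemma semigroup_lipschitz t v : dom A v -> 0 <= t -> `|T t v - v| <= t * `|A v|.
Proof.
move=> dv t0; apply: (norm_le_ip hip); first by rewrite mulr_ge0.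
move=> w.
have cv : {within `[0, t], continuous (T^~ v)}.
  exact: (semigroup_orbit_continuous hip dA nnA hT).
have cw : {within `[0, t], continuous (fun=> w)}.
  by apply: continuous_subspaceT => x; exact: cvg_cst.
have [|r] := MVT_segment t0 _ (within_continuous_ip hip cv cw)
    (df := fun r => - ip (T r (A v)) w).
  move=> r; rewrite in_itv/= => /andP[r0 _].
  have := is_derive_ip hip (semigroup_derive hip dA nnA hT dv r0)
    (is_derive_cst w r (1 : R)).
  by rewrite ip0r addr0 ipNl.
rewrite in_itv/= => /andP[r0 _]; rewrite subr0 (semigroup0 hT) -ipBl => ->.
rewrite normrM normrN (ger0_norm t0) mulrC -mulrA ler_wpM2l//.
apply: (le_trans (cauchy_schwarz hip _ _)); rewrite ler_wpM2r//.
exact: (semigroup_contraction hip dA nnA hT).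
Qed.

(** The mean value theorem is applied to the pairing with [w], and then the Lipschitz bound to the
    orbit of [A v]. Both [v] and [A v] lie in [range P], whence [a ^+ 2]. *)
Lemma semigroup_taylor t v : P v = v -> 0 <= t ->
  `|T t v - v + t *: A v| <= t ^+ 2 * (a ^+ 2 * `|v|).
Proof.
move=> Pv t0.
have dv : dom A v by rewrite -Pv.
have PAv : P (A v) = A v by rewrite -(rP dv).2 Pv.
have dAv : dom A (A v) by rewrite -PAv.
have AAv : `|A (A v)| <= a ^+ 2 * `|v|.
  rewrite -PAv; apply: le_trans (bndP _) _; rewrite expr2 -mulrA ler_wpM2l//.
  by rewrite -[in leLHS]Pv.
apply: (norm_le_ip hip); first by rewrite !mulr_ge0// exprn_ge0.
move=> w.
have cv : {within `[0, t], continuous (T^~ v)}.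
  exact: (semigroup_orbit_continuous hip dA nnA hT).
have cw : {within `[0, t], continuous (fun=> w)}.
  by apply: continuous_subspaceT => x; exact: cvg_cst.
have [|r] := MVT_segment t0 _ (within_continuous_ip hip cv cw)
    (df := fun r => - ip (T r (A v)) w).
  move=> r; rewrite in_itv/= => /andP[r0 _].
  have := is_derive_ip hip (semigroup_derive hip dA nnA hT dv r0)
    (is_derive_cst w r (1 : R)).
  by rewrite ip0r addr0 ipNl.
rewrite in_itv/= => /andP[r0 rt]; rewrite subr0 (semigroup0 hT) -ipBl => e.
rewrite ipDl e ipZl.
rewrite [X in `|X|](_ : _ = - (t * ip (T r (A v) - A v) w)); last by rewrite ipBl; ring.
rewrite normrN normrM (ger0_norm t0) expr2 -!mulrA ler_wpM2l//.
apply: (le_trans (cauchy_schwarz hip _ _)); rewrite !mulrA ler_wpM2r//.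
apply: (le_trans (semigroup_lipschitz dAv r0)).
by rewrite -2!mulrA (mulrA a) -expr2; apply: ler_pM.
Qed.

(** The base point [r0] may be either end of [[s, t]], so a single estimate yields both one-sided
    derivatives. The error splits into the forcing frozen at [r0] ([x1]), the second order term of
    the semigroup ([x2]) and the freezing of [A P u] ([x3]). *)
Lemma mild_projection_increment s t r0 eta :
  0 <= s -> s <= t -> s <= r0 <= t -> 0 <= eta ->
  (forall r, s <= r <= t -> `|u r - u r0| <= eta) ->
  `|P (u t) - P (u s) - (t - s) *: (- A (P (u r0)) + P (F (u r0)))|
    <= (t - s) * ((L + a) * eta + (t - s) * (a * M + a ^+ 2 * (`|u r0| + eta))).
Proof.
move=> s0 st sr eta0 close; have ts0 : 0 <= t - s by rewrite subr_ge0.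
have hI := mild_shift s0 st.
have ssr : `|u s - u r0| <= eta by apply: close; rewrite lexx.
have i1 : `|P (u t - T (t - s) (u s)) - (t - s) *: P (F (u r0))| <=
    ((t - s) * (a * M) + L * eta) * (t - s).
  apply: (is_integral_dist hip hP st _ hI).
    by rewrite addr_ge0 ?mulr_ge0// ltW.
  move=> r /andP[rs rt]; have tr0 : 0 <= t - r by rewrite subr_ge0.
  rewrite (semigroup_commute hip dA symA nnA hT)//.
  rewrite -[X in `|X - _|](subrK (P (F (u r)))) -addrA.
  apply: (le_trans (ler_normD _ _)); apply: lerD.
    apply: (le_trans (semigroup_lipschitz (domP _) tr0)).
    apply: ler_pM => //; first by rewrite lerD2l lerN2.
    by apply: (le_trans (bndP _)); rewrite ler_wpM2l.
  rewrite -(projB hP); apply: (le_trans (norm_proj hip hP _)).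
  by apply: (le_trans (hFL _ _)); rewrite ler_pM2l// close// rs.
have i2 := semigroup_taylor (projK hP (u s)) ts0.
have i3 : `|A (P (u s - u r0))| <= a * eta.
  by apply: (le_trans (bndP _)); rewrite ler_wpM2l.
rewrite (projB hP) (opB lA)// in i3.
rewrite (projB hP) (semigroup_commute hip dA symA nnA hT)// in i1.
have us : `|P (u s)| <= `|u r0| + eta.
  apply: (le_trans (norm_proj hip hP _)).
  rewrite -[u s](subrK (u r0)) addrC; apply: (le_trans (ler_normD _ _)).
  by rewrite lerD2l.
set x1 := P (u t) - _ - _ in i1; set x2 := T _ _ - _ + _ in i2.
set x3 := A _ - A _ in i3.
have -> : P (u t) - P (u s) - (t - s) *: (- A (P (u r0)) + P (F (u r0))) =
    x1 + x2 - (t - s) *: x3.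
  by apply: (ip_inj hip) => z; rewrite /x1 /x2 /x3 !ipE; ring.
apply: (le_trans (ler_normB _ _)).
rewrite normrZ (ger0_norm ts0).
have n12 := ler_normD x1 x2.
have m3 : (t - s) * `|x3| <= (t - s) * (a * eta) by rewrite ler_wpM2l.
have m2 : (t - s) ^+ 2 * (a ^+ 2 * `|P (u s)|) <=
    (t - s) ^+ 2 * (a ^+ 2 * (`|u r0| + eta)).
  by rewrite !ler_wpM2l ?sqr_ge0.
lra.
Qed.

Lemma mild_projection_derive t : 0 < t ->
  is_derive t (1 : R) (P \o u) (- A (P (u t)) + P (F (u t))).
Proof.
move=> t0; apply/is_derive_distP => e e0.
have La0 : 0 < L + a by rewrite ltr_pwDl.
(* [eta] makes the continuity error equal to [e / 2]; an increment below [e / (2 * K)] keeps the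
   quadratic error under the other half. The summand 1 in [K] ensures positivity. *)
pose eta := e / (2 * (L + a)).
have eta0 : 0 < eta by rewrite divr_gt0// mulr_gt0.
pose K := a * M + a ^+ 2 * (`|u t| + eta) + 1.
have K0 : 0 < K.
  have h1 : 0 <= a * M by rewrite mulr_ge0// ltW.
  have h2 : 0 <= a ^+ 2 * (`|u t| + eta) by rewrite mulr_ge0 ?sqr_ge0// addr_ge0// ltW.
  by rewrite ltr_wpDl// addr_ge0.
have [||d d0 hd] := within_continuous_dist cu (t := t) _ (e := eta) _ => //.
  by rewrite /= in_itv/= andbT ltW.
have ht : 0 < e / (2 * K) by rewrite divr_gt0// mulr_gt0.
(* The minimum with [t] keeps [s] nonnegative when it lies to the left of [t]. *)
exists (Num.min (Num.min d t) (e / (2 * K))); first by rewrite !lt_min d0 t0.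
move=> s; rewrite !lt_min => /andP[/andP[sd st] sk].
have fin x : 0 <= x -> x < e / (2 * K) -> 
    x * ((L + a) * eta + x * (a * M + a ^+ 2 * (`|u t| + eta))) <= e * x.
  move=> x0; rewrite ltr_pdivlMr ?mulr_gt0// => xk.
  rewrite (mulrC e) ler_wpM2l//.
  have -> : (L + a) * eta = e / 2 by rewrite /eta; field; rewrite gt_eqF.
  have le : x * (a * M + a ^+ 2 * (`|u t| + eta)) <= x * K.
    by rewrite ler_wpM2l// /K lerDl.
  by move: xk le; lra.
have [ts|/ltW ts] := leP t s.
  have e1 : `|s - t| = s - t by rewrite ger0_norm ?subr_ge0.
  rewrite e1 in sd sk *.
  have := @mild_projection_increment t s t eta (ltW t0) ts _ (ltW eta0) _.
  rewrite lexx ts => /(_ isT) h; apply: (le_trans (h _)); last by apply: fin; rewrite ?subr_ge0.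
  move=> r /andP[tr rs]; apply: hd; first by rewrite /= in_itv/= andbT (le_trans (ltW t0)).
  by rewrite ger0_norm ?subr_ge0// (le_lt_trans _ sd)// lerD2r.
have e1 : `|s - t| = t - s by rewrite ler0_norm ?subr_le0// opprB.
rewrite e1 in sd st sk *.
have s0 : 0 <= s by move: st; lra.
have := @mild_projection_increment s t t eta s0 ts _ (ltW eta0) _.
rewrite lexx ts => /(_ isT) h.
rewrite -normrN [X in `|X|](_ : _ = P (u t) - P (u s) - (t - s) *: (- A (P (u t)) + P (F (u t)))).
  apply: (le_trans (h _)); last by apply: fin; rewrite ?subr_ge0.
  move=> r /andP[sr rt]; apply: hd; first by rewrite /= in_itv/= andbT (le_trans s0).
  rewrite ler0_norm ?subr_le0// opprB (le_lt_trans _ sd)//.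
  by rewrite lerD2l lerN2.
by apply: (ip_inj hip) => z; rewrite /= !ipE; ring.
Qed.

End MildSolution.

(** * Comparison of the projected equations *)

Section Gronwall.
Context (R : realType).
Implicit Types (g dg : R -> R).

(* The layer term [Lam * expR (- Lam t)] has integral at most [1] uniformly in
   [Lam], so it costs only a factor [e] in the integrating factor. *)
Lemma gronwall_layer g dg (K Lam c b tau : R) :
  0 <= K -> 0 < Lam -> 0 <= c -> 0 <= b -> 0 <= tau ->
  {within `[0, tau], continuous g} -> g 0 = 0 -> 0 <= g tau ->
  (forall t, 0 < t < tau -> is_derive t (1 : R) g (dg t) /\
    dg t <= (K + Lam * expR (- (Lam * t))) * g t + c * Lam * expR (- (Lam * t)) + b) ->
  g tau <= expR (K * tau + 1) * (c + b * tau).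
Proof.
move=> K0 Lam0 c0 b0 tau0 cg g0 gtau hg.
pose E t := expR (- (Lam * t)).
(* The logarithmic derivative of [I] is [- K - Lam * E t], which cancels the whole coefficient of
   [g]. Since [E t <= 1] for nonnegative [t], [I] stays below [expR 1], so the second part of [m]
   dominates the integrated inhomogeneity. *)
pose I t := expR (- (K * t) + E t).
pose m t := I t * g t + expR 1 * (c * E t - b * t).
have dE t : is_derive t (1 : R) E (- (Lam * E t)).
  by apply: is_derive_eq; rewrite /E /GRing.scale/=; ring.
have dI t : is_derive t (1 : R) I (I t * (- K - Lam * E t)).
  by have ? := dE t; apply: is_derive_eq; rewrite /I /GRing.scale/=; ring.
have contd (f df : R -> R) : (forall t, is_derive t (1 : R) f (df t)) -> continuous f.
  by move=> h t; apply: differentiable_continuous; apply/derivable1_diffP; case: (h t).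
have E1 t : 0 <= t -> E t <= 1.
  by move=> t0; rewrite /E -expR0 ler_expR oppr_le0 mulr_ge0// ltW.
have c2 : continuous (fun t => expR 1 * (c * E t - b * t)).
  move=> t; apply: cvgMr; apply: cvgB; apply: cvgMr; last exact: cvg_id.
  exact: (contd _ _ dE).
have cm : {within `[0, tau], continuous m}.
  move=> x; apply: cvgD.
    by apply: cvgM; [exact: (continuous_subspaceT (contd _ _ dI))|exact: cg].
  exact: (continuous_subspaceT c2).
have : m tau <= m 0.
  apply: (nonincreasing_of_derive tau0 cm
    (df := fun t => I t * (dg t - (K + Lam * E t) * g t)
                    - expR 1 * (c * Lam * E t + b))) => t tt.
  have [dgt le] := hg t tt; have /andP[t0 _] := tt; split.
    have ? := dE t; have ? := dI t.
    by apply: is_derive_eq; rewrite /GRing.scale/=; ring.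
  have II : I t <= expR 1.
    rewrite ler_expR (le_trans _ (E1 _ (ltW t0)))// gerDr oppr_le0.
    by rewrite mulr_ge0// ltW.
  have I0 : 0 < I t by exact: expR_gt0.
  have r0 : 0 <= c * Lam * E t + b.
    by rewrite addr_ge0// !mulr_ge0 ?expR_ge0// ltW.
  rewrite subr_le0; apply: (@le_trans _ _ (I t * (c * Lam * E t + b))).
    by rewrite ler_pM2l//; move: le; rewrite -/(E t); lra.
  by rewrite ler_wpM2r.
rewrite /m g0 mulr0 add0r mulr0 subr0 => h.
have Etau := expR_ge0 (- (Lam * tau)); rewrite -/(E tau) in Etau.
have E0 : E 0 <= 1 by exact: E1.
have e1 : 0 < expR (1 : R) by exact: expR_gt0.
have {}h : I tau * g tau <= expR 1 * (c + b * tau).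
  have k1 : c * E 0 <= c by rewrite ler_piMr.
  have k2 : 0 <= c * E tau by rewrite mulr_ge0.
  have k3 : expR 1 * (c * E 0 - c * E tau + b * tau) <= expR 1 * (c + b * tau).
    by rewrite ler_pM2l//; lra.
  by lra.
rewrite expRD -mulrA -ler_pdivrMl ?expR_gt0// -expRN; apply: le_trans h.
by rewrite ler_wpM2r// ler_expR lerDl.
Qed.

Lemma gronwall_decay g dg (s b t0 t : R) :
  0 < s -> 0 <= b -> t0 <= t -> {within `[t0, t], continuous g} -> 0 <= g t0 ->
  (forall r, t0 < r < t -> is_derive r (1 : R) g (dg r) /\ dg r <= - s * g r + b) ->
  g t <= g t0 + b / s.
Proof.
move=> s0 b0 tt cg g0 hg.
pose E (r : R) := expR (s * r).
have dE r : is_derive r (1 : R) E (s * E r).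
  by apply: is_derive_eq; rewrite /E /GRing.scale/=; ring.
have cE : continuous E.
  by move=> r; apply: differentiable_continuous; apply/derivable1_diffP; case: (dE r).
pose m r := E r * (g r - b / s).
have cm : {within `[t0, t], continuous m}.
  move=> x; apply: cvgM; first exact: (continuous_subspaceT cE).
  by apply: cvgB; [exact: cg|exact: cvg_cst].
have : m t <= m t0.
  apply: (nonincreasing_of_derive tt cm
    (df := fun r => E r * (dg r - (- s * g r + b)))) => r rr.
  have [dgr le] := hg r rr; split.
    have ? := dE r; apply: is_derive_eq; rewrite /GRing.scale/=; field.
    by rewrite gt_eqF.
  by rewrite pmulr_rle0 ?expR_gt0// subr_le0.
rewrite /m => h; have bs : 0 <= b / s by rewrite divr_ge0// ltW.
have [le|lt] := leP (g t) (b / s); first by rewrite (le_trans le)// lerDr.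
rewrite -lerBlDr; have EE : E t0 <= E t by rewrite ler_expR ler_pM2l.
have Et : 0 < E t by exact: expR_gt0.
rewrite -(ler_pM2l Et); apply: (le_trans h).
have E0 : 0 < E t0 by exact: expR_gt0.
have k1 : E t0 * (g t0 - b / s) <= E t0 * g t0 by rewrite ler_pM2l// gerBl.
by apply: (le_trans k1); rewrite ler_wpM2r.
Qed.

End Gronwall.

(** * Energy estimates for the difference of two projected solutions *)

Section Comparison.
Context (R : realType) (H : completeNormedModType R) (ip : {dot H for idfun}).
Hypothesis hip : induces_norm ip.
Context (A : partial_op H) (P : H -> H).
Implicit Types (s t : R) (x y : H) (p q : R -> H).
Hypothesis lA : linear_op A.
Hypothesis nnA : nonnegative_op ip A.
Hypothesis hP : orthogonal_projection ip P.
Hypothesis domP : forall x, dom A (P x).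

(** The forcing [f] is left free so that orbits of both semiflows and of the reduced flow fit.
    Continuity up to 0 carries the initial value; the equation is imposed for positive times, where
    a two-sided derivative makes sense for an orbit on [[0, +oo[]. *)
Definition solves_projected (f p : R -> H) : Prop :=
  [/\ {within `[0, +oo[, continuous p}, forall t, 0 <= t -> P (p t) = p t &
      forall t, 0 < t -> is_derive t (1 : R) p (- A (p t) + P (f t))].

Section TwoSolutions.
Context (f1 f2 p1 p2 : R -> H).
Hypothesis sol1 : solves_projected f1 p1.
Hypothesis sol2 : solves_projected f2 p2.
Local Notation g := (fun t => ip (p1 t - p2 t) (p1 t - p2 t)).
Local Notation dg := (fun t => 2 * (ip (f1 t - f2 t) (p1 t - p2 t)
                                    - ip (A (p1 t - p2 t)) (p1 t - p2 t))).

Lemma energy_continuous (D : set R) : D `<=` `[0, +oo[ -> {within D, continuous g}.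
Proof.
move=> sub; case: sol1 => c1 _ _; case: sol2 => c2 _ _.
have c : {within D, continuous (fun t => p1 t - p2 t)}.
  move=> x; apply: cvgB; [exact: (continuous_subspaceW sub c1)|].
  exact: (continuous_subspaceW sub c2).
exact: (within_continuous_ip hip c c).
Qed.

Lemma energy_derive t : 0 < t -> is_derive t (1 : R) g (dg t).
Proof.
move=> t0; case: sol1 => _ e1 /(_ t t0) d1; case: sol2 => _ e2 /(_ t t0) d2.
have dw : is_derive t (1 : R) (fun t => p1 t - p2 t)
    (- A (p1 t) + P (f1 t) - (- A (p2 t) + P (f2 t))) by exact: is_deriveB.
apply: (is_derive_eq (is_derive_ip hip dw dw)).
have t0' := ltW t0.
have Pw : P (p1 t - p2 t) = p1 t - p2 t by rewrite (projB hP) e1// e2.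
have dp1 : dom A (p1 t) by rewrite -(e1 t t0'); exact: domP.
have dp2 : dom A (p2 t) by rewrite -(e2 t t0'); exact: domP.
rewrite (opB lA dp1 dp2).
have k f : ip (P f) (p1 t - p2 t) = ip f (p1 t - p2 t) by exact: (ip_projr hP).
rewrite (ipC ip (p1 t - p2 t)) !ipDl !ipNl !ipDl !k !ipNl; ring.
Qed.

End TwoSolutions.

(** Serves to identify the projected orbit on the manifold with [Phi], since it is the orbit of
    [Phi] that is assumed to enter [V]. *)
Lemma reduced_flow_unique (G : H -> H) (K : R) p1 p2 : 0 <= K ->
  (forall x y, P x = x -> P y = y -> `|G x - G y| <= K * `|x - y|) ->
  solves_projected (G \o p1) p1 -> solves_projected (G \o p2) p2 ->
  p1 0 = p2 0 -> forall t, 0 <= t -> p1 t = p2 t.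
Proof.
move=> K0 lip sol1 sol2 e0 t t0.
have cg := energy_continuous sol1 sol2 (D := `[0, t]).
have sub : `[0, t] `<=` `[0, +oo[.
  by move=> x /=; rewrite !in_itv/= => /andP[->].
have K20 : 0 <= 2 * K by rewrite mulr_ge0.
have h : ip (p1 t - p2 t) (p1 t - p2 t) <= expR (2 * K * t + 1) * (0 + 0 * t).
  (* With [c = b = 0] the bound is 0. The choice [Lam = 1] is arbitrary: the layer coefficient
     multiplies the nonnegative [g] and only enlarges the right-hand side. *)
  apply: (gronwall_layer K20 ltr01 (lexx 0) (lexx 0) t0 (cg sub)
    (dg := fun t => 2 * (ip (G (p1 t) - G (p2 t)) (p1 t - p2 t)
                         - ip (A (p1 t - p2 t)) (p1 t - p2 t)))).
  - by rewrite e0 subrr ip0l.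
  - exact: ip_ge0.
  move=> s /andP[s0 st]; split; first exact: (energy_derive sol1 sol2).
  case: sol1 => _ /(_ s (ltW s0)) e1 _; case: sol2 => _ /(_ s (ltW s0)) e2 _.
  have nn : 0 <= ip (A (p1 s - p2 s)) (p1 s - p2 s).
    by apply: nnA; rewrite -e1 -e2 -(projB hP).
  have h1 : ip (G (p1 s) - G (p2 s)) (p1 s - p2 s) <= K * ip (p1 s - p2 s) (p1 s - p2 s).
    apply: (le_trans (ip_le hip _ _)); rewrite (ip_norm hip) expr2 mulrA.
    by rewrite ler_wpM2r// lip.
  have h2 : 0 <= expR (- (1 * s)) * ip (p1 s - p2 s) (p1 s - p2 s).
    by rewrite mulr_ge0 ?expR_ge0 ?ip_ge0.
  by move: nn h1 h2 => /=; lra.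
apply/eqP; rewrite -subr_eq0 -normr_eq0 -sqrf_eq0 eq_le sqr_ge0 andbT -(ip_norm hip).
by apply: (le_trans h); rewrite mul0r addr0 mulr0.
Qed.

Section ReductionError.
Context (F h : H -> H) (M L Lam sigma C tstar : R) (u v : R -> H) (p q : R -> H).
Hypothesis hL : 0 < L.
Hypothesis hM : 0 < M.
Hypothesis hLam : 0 < Lam.
Hypothesis hsigma : 0 < sigma.
Hypothesis hC : 0 <= C.
Hypothesis htstar : 0 <= tstar.
Hypothesis hFL : forall x y, `|F x - F y| <= L * `|x - y|.
Hypothesis solp : solves_projected (F \o u) p.
Hypothesis solq : solves_projected (F \o v) q.
Hypothesis pq0 : p 0 = q 0.
Hypothesis hv : forall t, 0 <= t -> v t = q t + h (q t).
Hypothesis hh : forall x, P x = x -> `|h x| <= M / Lam.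
Hypothesis hu : forall t, 0 <= t -> `|u t - p t| <= expR (- (Lam * t)) * C + M / Lam.
Hypothesis mono : forall t, tstar <= t ->
  sigma * `|p t - q t| ^+ 2 <=
  ip (A (p t - q t) - P (F (p t + h (p t)) - F (q t + h (q t)))) (p t - q t).

Local Notation g t := (ip (p t - q t) (p t - q t)).
Local Notation dg t := (2 * (ip (F (u t) - F (v t)) (p t - q t)
                             - ip (A (p t - q t)) (p t - q t))).

(** The bound of [gronwall_layer] at time [tstar + 1], with the common factor [1 / Lam ^+ 2] of its
    [c] and [b] taken out; what remains is independent of [Lam]. *)
Definition layer_const : R :=
  expR ((2 * L + 1) * (tstar + 1) + 1) *
    (L ^+ 2 * C ^+ 2 + 4 * L ^+ 2 * M ^+ 2 * (tstar + 1)).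

Lemma reduction_error_initial t : 0 <= t <= tstar + 1 -> g t <= layer_const / Lam ^+ 2.
Proof.
move=> /andP[t0 tt].
have sub : `[0, t] `<=` `[0, +oo[.
  by move=> x /=; rewrite !in_itv/= => /andP[->].
(* In the rate, [2 * L] comes from the Lipschitz bound on [|w|] and 1 from the AM-GM inequality
   [y2]. The two contributions [M / Lam] to [uv], from [u - p] and from [h q], give the 4 in [b]. *)
have K0 : 0 <= 2 * L + 1 by rewrite addr_ge0// mulr_ge0// ltW.
pose c := L ^+ 2 * C ^+ 2 / Lam ^+ 2.
pose b := 4 * L ^+ 2 * M ^+ 2 / Lam ^+ 2.
have c0 : 0 <= c by apply: divr_ge0; [apply: mulr_ge0|]; exact: sqr_ge0.
have b0 : 0 <= b.
  by apply: divr_ge0; [apply: mulr_ge0; [apply: mulr_ge0|]|]; rewrite // sqr_ge0.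
have gr : g t <= expR ((2 * L + 1) * t + 1) * (c + b * t).
  apply: (gronwall_layer K0 hLam c0 b0 t0 (energy_continuous solp solq sub)
    (dg := fun t => dg t)).
  - by rewrite pq0 subrr ip0l.
  - exact: ip_ge0.
  move=> s /andP[s0 st]; have s0' := ltW s0; split; first exact: (energy_derive solp solq).
  have [_ /(_ s s0') ep _] := solp; have [_ /(_ s s0') eq _] := solq.
  have nn : 0 <= ip (A (p s - q s)) (p s - q s).
    by apply: nnA; rewrite -ep -eq -(projB hP).
  set w := p s - q s in nn *.
  have uv : `|u s - v s| <= `|w| + (expR (- (Lam * s)) * C + 2 * (M / Lam)).
    rewrite (hv s0') (_ : _ - _ = w + (u s - p s) - h (q s)); last first.
      by apply: (ip_inj hip) => z; rewrite /w !ipE; ring.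
    apply: (le_trans (ler_normB _ _)); have := ler_normD w (u s - p s).
    by have := hh eq; have := hu s0'; lra.
  have k : ip (F (u s) - F (v s)) w <=
      L * (`|w| + (expR (- (Lam * s)) * C + 2 * (M / Lam))) * `|w|.
    apply: (le_trans (ip_le hip _ _)); rewrite ler_wpM2r//.
    by apply: (le_trans (hFL _ _)); rewrite ler_pM2l.
  rewrite (ip_norm hip); move: k nn; set E := expR _.
  have E0 : 0 <= E by exact: expR_ge0.
  set n := `|w| => k nn.
  (* AM-GM, weighted by [Lam] on the layer term. *)
  have y1 : 2 * (L * C * n) <= Lam * n ^+ 2 + c * Lam.
    have := sqr_ge0 (Lam * n - L * C); rewrite sqrrB => y.
    rewrite -(ler_pM2l hLam) /c.
    have -> : Lam * (Lam * n ^+ 2 + L ^+ 2 * C ^+ 2 / Lam ^+ 2 * Lam) =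
      (Lam * n) ^+ 2 + (L * C) ^+ 2 by field; rewrite gt_eqF.
    by move: y; rewrite -mulr_natl; lra.
  have y2 : 2 * (L * (2 * (M / Lam)) * n) <= n ^+ 2 + b.
    have := sqr_ge0 (n - L * (2 * (M / Lam))); rewrite sqrrB => y.
    have -> : b = (L * (2 * (M / Lam))) ^+ 2 by rewrite /b; field; rewrite gt_eqF.
    by move: y; rewrite -mulr_natl; lra.
  have y3 := ler_wpM2l E0 y1.
  by lra.
apply: (le_trans gr).
have -> : layer_const / Lam ^+ 2 =
    expR ((2 * L + 1) * (tstar + 1) + 1) * (c + b * (tstar + 1)).
  by rewrite /layer_const /c /b; field; rewrite gt_eqF.
have cb0 : 0 <= c + b * t by rewrite addr_ge0// mulr_ge0.
apply: (ler_pM (expR_ge0 _) cb0).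
  by rewrite ler_expR lerD2r ler_wpM2l.
by rewrite lerD2l ler_wpM2l.
Qed.

(** The second summand is [b / sigma] from [gronwall_decay], again without its factor
    [1 / Lam ^+ 2]. *)
Definition reduction_const : R :=
  layer_const + L ^+ 2 * (C + 2 * M) ^+ 2 / sigma ^+ 2.

Lemma reduction_error t : 0 <= t -> g t <= reduction_const / Lam ^+ 2.
Proof.
move=> t0.
have r0 : 0 <= L ^+ 2 * (C + 2 * M) ^+ 2 / sigma ^+ 2.
  by apply: divr_ge0; [apply: mulr_ge0|]; exact: sqr_ge0.
have [tt|/ltW tt] := leP t (tstar + 1).
  apply: (le_trans (reduction_error_initial _)); first by rewrite t0.
  by rewrite ler_pM2r ?invr_gt0 ?exprn_gt0// lerDl.
have ts0 : 0 <= tstar + 1 by rewrite addr_ge0.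
have sub : `[tstar + 1, t] `<=` `[0, +oo[.
  by move=> x /=; rewrite !in_itv/= => /andP[/(le_trans ts0) ->].
pose b := L ^+ 2 * (C + 2 * M) ^+ 2 / (sigma * Lam ^+ 2).
have b0 : 0 <= b.
  by apply: divr_ge0; apply: mulr_ge0; rewrite ?sqr_ge0// ltW.
have gr : g t <= g (tstar + 1) + b / sigma.
  apply: (gronwall_decay hsigma b0 tt (energy_continuous solp solq sub)
    (dg := fun t => dg t)); first exact: ip_ge0.
  move=> s /andP[s1 st]; have s0 : 0 < s by rewrite (le_lt_trans ts0).
  have s0' := ltW s0; split; first exact: (energy_derive solp solq).
  have [_ /(_ s s0') ep _] := solp; have [_ /(_ s s0') eq _] := solq.
  have := mono (t := s); rewrite (le_trans _ (ltW s1)) ?lerDl// => /(_ isT).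
  set w := p s - q s.
  have Pw : P w = w by rewrite (projB hP) ep eq.
  rewrite ipBl (ip_projr hP)// => mon.
  (* The extra unit of time is spent here: [s >= 1] and [1 + x <= expR x] give the bound, which
     fails near [s = 0]. *)
  have layer : expR (- (Lam * s)) <= Lam^-1.
    rewrite expRN lef_pV2 ?posrE ?expR_gt0//.
    apply: (le_trans _ (expR_ge1Dx _)).
    have : Lam * 1 <= Lam * s by rewrite ler_pM2l// (le_trans _ (ltW s1))// lerDr.
    by lra.
  have up : `|u s - (p s + h (p s))| <= (C + 2 * M) / Lam.
    rewrite opprD addrA; apply: (le_trans (ler_normB _ _)).
    have l1 := hu s0'; have l2 := hh ep; have l3 := ler_wpM2r hC layer.
    by rewrite mulrDl; lra.
  have k : ip (F (u s) - F (p s + h (p s))) w <= L * ((C + 2 * M) / Lam) * `|w|.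
    apply: (le_trans (ip_le hip _ _)); rewrite ler_wpM2r//.
    by apply: (le_trans (hFL _ _)); rewrite ler_pM2l.
  (* The second difference is taken between graph points and is controlled by [mon]; the first is
     the distance of the true orbit from the graph, of order [1 / Lam]. *)
  have split : ip (F (u s) - F (v s)) w = ip (F (u s) - F (p s + h (p s))) w +
      ip (F (p s + h (p s)) - F (q s + h (q s))) w.
    by rewrite -(hv s0') -ipDl addrA subrK.
  rewrite split (ip_norm hip); move: k mon; set n := `|w| => k mon.
  (* Half of the dissipation [2 * sigma * n ^+ 2] absorbs the cross term; the remaining [sigma] is
     the decay rate. *)
  have y : 2 * (L * ((C + 2 * M) / Lam) * n) <= sigma * n ^+ 2 + b.
    have := sqr_ge0 (sigma * n - L * ((C + 2 * M) / Lam)); rewrite sqrrB => y.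
    rewrite -(ler_pM2l hsigma) /b.
    have -> : sigma * (sigma * n ^+ 2 + L ^+ 2 * (C + 2 * M) ^+ 2 / (sigma * Lam ^+ 2)) =
      (sigma * n) ^+ 2 + (L * ((C + 2 * M) / Lam)) ^+ 2 by field; rewrite !gt_eqF.
    by move: y; rewrite -mulr_natl; lra.
  lra.
apply: (le_trans gr); rewrite /reduction_const mulrDl; apply: lerD.
  by apply: reduction_error_initial; rewrite ts0 lexx.
by rewrite le_eqVlt; apply/orP; left; apply/eqP; rewrite /b; field; rewrite !gt_eqF.
Qed.

End ReductionError.
End Comparison.

(** * Projected equations of the original and the perturbed semiflow *)

Section MildSemiflow.
Context (R : realType) (H : completeNormedModType R) (ip : {dot H for idfun}).
Hypothesis hip : induces_norm ip.
Context (A : partial_op H) (P : H -> H) (a : R).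
Implicit Types (t : R) (u v w : H).
Hypothesis lA : linear_op A.
Hypothesis symA : symmetric_op ip A.
Hypothesis nnA : nonnegative_op ip A.
Hypothesis hP : orthogonal_projection ip P.
Hypothesis rP : reduces P A.
Hypothesis a0 : 0 <= a.
Hypothesis domP : forall v, dom A (P v).
Hypothesis bndP : forall v, `|A (P v)| <= a * `|v|.

Lemma mild_semiflow_initial (F : H -> H) (S : R -> H -> H) :
  is_mild_semiflow ip A F S -> forall u, S 0 u = u.
Proof.
by move=> [T hT h] u; have [_ mild] := h u; exact: (mild_initial hip hT mild).
Qed.

Lemma mild_semiflow_projected (F : H -> H) (M L : R) (S : R -> H -> H) u :
  dense (dom A) -> 0 < M -> 0 < L -> (forall v, `|F v| <= M) ->
  (forall v w, `|F v - F w| <= L * `|v - w|) -> is_mild_semiflow ip A F S ->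
  solves_projected A P (fun t => F (S t u)) (fun t => P (S t u)).
Proof.
move=> dA hM hL hFM hFL [T hT h]; have [cu mild] := h u; split.
- exact: (within_continuous_proj hip hP cu).
- by move=> t _; exact: (projK hP).
- by move=> t; exact: (mild_projection_derive hip lA dA symA nnA hT hM hL hFM hFL
    cu mild hP rP a0 domP bndP).
Qed.

Section Perturbed.
Context (eps : R).
Hypothesis eps0 : 0 < eps.
Local Notation Ae := (perturbed A P eps).

Lemma perturbed_linear : linear_op Ae.
Proof.
move=> c u v du dv; have [duv e] := lA c du dv; split=> //=.
rewrite e /compl (projD hP) (projZ hP).
by apply: (ip_inj hip) => z; rewrite !ipE; ring.
Qed.

Lemma perturbed_symmetric : symmetric_op ip Ae.
Proof.
move=> u v du dv; rewrite /= ipDl ipDr symA// ipZl ipZr.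
by rewrite (ip_proj (compl_proj hP)).
Qed.

Lemma perturbed_nonnegative : nonnegative_op ip Ae.
Proof.
move=> u du; rewrite /= ipDl ipZl (ip_proj_sqr hip (compl_proj hP)).
by rewrite addr_ge0 ?nnA// mulr_ge0 ?sqr_ge0// invr_ge0 ltW.
Qed.

Lemma perturbed_proj u : Ae (P u) = A (P u).
Proof. by rewrite /= (proj_complK hP) scaler0 addr0. Qed.

Lemma perturbed_reduces : reduces P Ae.
Proof.
move=> u du; have [dPu e] := rP du; split=> //; rewrite perturbed_proj e /=.
by rewrite (projD hP) (projZ hP) (compl_projK hP) scaler0 addr0.
Qed.

End Perturbed.
End MildSemiflow.

(** The added term [eps^-1 (1 - P)] vanishes on [range P], so the projected equation involves [A]
    itself and the bound [a] is unchanged. *)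
Lemma perturbed_semiflow_projected (R : realType) (H : completeNormedModType R)
    (ip : {dot H for idfun}) (A : partial_op H) (P : H -> H) (a eps M L : R)
    (F : H -> H) (S : R -> H -> H) (u : H) :
  induces_norm ip -> linear_op A -> symmetric_op ip A -> nonnegative_op ip A ->
  orthogonal_projection ip P -> reduces P A -> 0 <= a ->
  (forall v, dom A (P v)) -> (forall v, `|A (P v)| <= a * `|v|) ->
  dense (dom A) -> 0 < eps -> 0 < M -> 0 < L -> (forall v, `|F v| <= M) ->
  (forall v w, `|F v - F w| <= L * `|v - w|) ->
  is_mild_semiflow ip (perturbed A P eps) F S ->
  solves_projected A P (fun t => F (S t u)) (fun t => P (S t u)).
Proof.
move=> hip lA symA nnA hP rP a0 domP bndP dA eps0 hM hL hFM hFL hS.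
have bndPe v : `|perturbed A P eps (P v)| <= a * `|v| by rewrite (perturbed_proj A hP).
have [c PK d] := mild_semiflow_projected hip (perturbed_linear hip lA hP (eps := eps))
  (perturbed_symmetric symA hP (eps := eps)) (perturbed_nonnegative hip nnA hP eps0)
  hP (perturbed_reduces hP rP (eps := eps)) a0 domP bndPe u dA hM hL hFM hFL hS.
split=> // t t0; have := d t t0.
by rewrite (perturbed_proj A hP).
Qed.

(** * From the reduction error to the distance on the manifold *)

Theorem theorem4p16
  (R : realType) (H : completeNormedModType R) (ip : {dot H for idfun})
  (hip : induces_norm ip) (hdim : infinite_dimensional H)
  (A : partial_op H) (hsa : self_adjoint ip A) (hnn : nonnegative_op ip A)
  (hcr : compact_resolvent A)
  (E : set R -> H -> H) (hE : is_spectral_measure ip A E)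
  (F : H -> H) (M L : R) (hM : 0 < M) (hL : 0 < L)
  (hFM : forall u, `|F u| <= M)
  (hFL : forall u w, `|F u - F w| <= L * `|u - w|)
  (mu : R) (hmu : 0 < mu)
  (S : R -> H -> H) (hS : is_mild_semiflow ip A F S)
  (Seps : R -> R -> H -> H)
  (hSeps : forall eps, 0 < eps <= 1 ->
     is_mild_semiflow ip (perturbed A (Peps E mu eps) eps) F (Seps eps))
  (h : R -> H -> H)
  (hh : forall eps, 0 < eps <= 1 -> 8 * L <= gap A (Peps E mu eps) eps ->
     inertial_graph A (Peps E mu eps) eps M L (Seps eps) (h eps))
  (Phi : R -> R -> H -> H)
  (hPhi : forall eps, 0 < eps <= 1 -> 8 * L <= gap A (Peps E mu eps) eps ->
     is_reduced_flow A (Peps E mu eps) F (h eps) (Phi eps))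
  (B : set H) (hB : bounded_set B)
  (V : R -> set H)
  (hV : \forall eps \near 0^'+, V eps `<=` range (Peps E mu eps))
  (sigma : R) (hsigma : 0 < sigma)
  (hmono : \forall eps \near 0^'+, forall p1 p2, V eps p1 -> V eps p2 ->
     sigma * `|p1 - p2| ^+ 2 <=
     ip (A (p1 - p2)
         - Peps E mu eps (F (p1 + h eps p1) - F (p2 + h eps p2))) (p1 - p2))
  (tstar : R) (htstar : 0 <= tstar)
  (habs : \forall eps \near 0^'+, forall u0 t, B u0 -> tstar <= t ->
     V eps (Peps E mu eps (S t u0)) /\
     V eps (Phi eps t (Peps E mu eps u0))) :
  exists CB : R, \forall eps \near 0^'+,
    forall u0 t, B u0 -> 0 <= t ->
      `|Rmap (Peps E mu eps) (h eps) (S t u0)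
        - Seps eps t (Rmap (Peps E mu eps) (h eps) u0)| <= CB * eps ^+ 2.
Proof.
have [lA dA _] := hsa; have symA := self_adjoint_symmetric hsa.
have [C C0 BC] : exists2 C : R, 0 <= C & forall u, B u -> `|u| <= C.
  have [C [_ hC]] := hB; exists (`|C| + 1); first by rewrite addr_ge0.
  by move=> u Bu; apply: (hC (`|C| + 1)) => //; rewrite (le_lt_trans (ler_norm _))// ltrDl.
pose D := reduction_const M L sigma C tstar.
(* The error on the graph is at most [2 |p - q|], the square of [|p - q|] is at most [D / Lam ^+ 2],
   and [1 / Lam = eps ^+ 2 / mu]. The constant is fixed before [eps] is introduced. *)
exists (2 * (Num.sqrt D / mu)).
near=> eps.
have eps0 : 0 < eps by near: eps; exact: nbhs_right_gt.
have eps1 : eps <= 1 by near: eps; exact: nbhs_right_le.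
have epsL : eps <= (8 * L)^-1.
  by near: eps; apply: nbhs_right_le; rewrite invr_gt0 mulr_gt0.
have monoV : forall p1 p2, V eps p1 -> V eps p2 ->
     sigma * `|p1 - p2| ^+ 2 <=
     ip (A (p1 - p2)
         - Peps E mu eps (F (p1 + h eps p1) - F (p2 + h eps p2))) (p1 - p2).
  by near: eps.
have absV : forall u0 t, B u0 -> tstar <= t ->
     V eps (Peps E mu eps (S t u0)) /\
     V eps (Phi eps t (Peps E mu eps u0)) by near: eps.
have eps01 : 0 < eps <= 1 by rewrite eps0.
set P := Peps E mu eps in monoV absV *.
pose Lam := mu / eps ^+ 2.
have Lam0 : 0 < Lam by rewrite divr_gt0// exprn_gt0.
have hP : orthogonal_projection ip P by apply: (spectral_proj hE); exact: measurable_itv.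
have hQ := compl_proj hP.
have rP : reduces P A by exact: (cutoff_reduces hip hsa hnn hE).
have rQ := compl_reduces lA rP.
have domP v : dom A (P v) by exact: (dom_cutoff hip hE).
have bndP v : `|A (P v)| <= Lam * `|v|.
  exact: (cutoff_op_bounded hip hsa hnn hE (ltW Lam0)).
have lowQ v : dom A v -> compl P v = v -> Lam * `|v| ^+ 2 <= ip (A v) v.
  move=> dv Qv; apply: (cutoff_compl_form_ge hip hnn hE (ltW Lam0) dv).
  by rewrite -Qv; exact: (compl_projK hP).
have lamP : Lam <= lambda_plus A P.
  exact: (lambda_plus_ge hip hsa hnn hE (ltW Lam0) hdim hcr).
have betaP : beta A P <= Lam by exact: (beta_le hip hsa hnn hE (ltW Lam0)).
have ei0 : 0 < eps^-1 by rewrite invr_gt0.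
have gapP : 8 * L <= gap A P eps.
  have : 8 * L <= eps^-1 by rewrite -[8 * L]invrK lef_pV2 ?posrE ?invr_gt0 ?mulr_gt0.
  by rewrite /gap /alpha; lra.
have [hran hbnd hlip hinv] := hh _ eps01 gapP.
have hflow := hPhi _ eps01 gapP.
set hq := h eps in monoV hran hbnd hlip hinv hflow *.
have hLam x : P x = x -> `|hq x| <= M / Lam.
  move=> /(range_proj hP) rx; apply: (le_trans (hbnd _ rx)).
  rewrite ler_pM2l// lef_pV2 ?posrE//; last by rewrite /alpha; lra.
  by rewrite /alpha; lra.
have gap0 : 0 < gap A P eps by rewrite (lt_le_trans _ gapP)// mulr_gt0.
have hhalf x y : P x = x -> P y = y -> `|hq x - hq y| <= 2^-1 * `|x - y|.
  move=> /(range_proj hP) rx /(range_proj hP) ry; apply: (le_trans (hlip _ _ rx ry)).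
  by rewrite ler_wpM2r// ler_pdivrMr//; lra.
have Phq x : P x = x -> P (hq x) = 0.
  by move=> /(range_proj hP) /hran[z _ <-]; exact: (compl_projK hP).
move=> u0 t Bu0 t0.
pose u s := S s u0; pose v s := Seps eps s (Rmap P hq u0).
pose p s := P (u s); pose q s := P (v s).
have PPu : P (P u0) = P u0 by exact: (projK hP).
(* Invariance keeps [v s] on the graph; as [h] takes values in the kernel of [P], applying [P]
   recovers the base point. *)
have vE s : 0 <= s -> v s = q s + hq (q s).
  move=> s0; have : graph_over P hq (v s).
    rewrite -(hinv s s0); exists (Rmap P hq u0) => //.
    by exists (P u0) => //; apply/(range_proj hP).
  move=> [x /(range_proj hP) Px xv].
  suff -> : q s = x by [].
  by rewrite /q -xv (projD hP) Px (Phq _ Px) addr0.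
have solp : solves_projected A P (F \o u) p.
  exact: (mild_semiflow_projected hip lA symA hnn hP rP (ltW Lam0) domP bndP u0
    dA hM hL hFM hFL hS).
have solq : solves_projected A P (F \o v) q.
  exact: (perturbed_semiflow_projected (Rmap P hq u0) hip lA symA hnn hP rP
    (ltW Lam0) domP bndP dA eps0 hM hL hFM hFL (hSeps _ eps01)).
have q0 : q 0 = P u0.
  rewrite /q /v (mild_semiflow_initial hip (hSeps _ eps01)) /Rmap (projD hP) PPu.
  by rewrite (Phq _ PPu) addr0.
pose G x := F (x + hq x).
have solq' : solves_projected A P (G \o q) q.
  have [c PK d] := solq; split=> // s s0; have := d s s0.
  by rewrite /= (vE s (ltW s0)).
have rPu0 : range P (P u0) by apply/(range_proj hP).
have [Phi0 dPhi] := hflow _ rPu0.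
have solPhi : solves_projected A P (G \o (fun s => Phi eps s (P u0)))
    (fun s => Phi eps s (P u0)).
  split.
  - apply: continuous_subspaceT => s; apply: differentiable_continuous.
    by apply/derivable1_diffP; case: (dPhi s) => _ [].
  - by move=> s _; apply/(range_proj hP); case: (dPhi s).
  - by move=> s _; case: (dPhi s).
have G_lip x y : P x = x -> P y = y -> `|G x - G y| <= (2 * L) * `|x - y|.
  move=> Px Py; apply: (le_trans (hFL _ _)).
  rewrite opprD addrACA; have := hhalf _ _ Px Py.
  have := ler_normD (x - y) (hq x - hq y); have := normr_ge0 (x - y).
  by move: `|_ + _| `|hq x - _| `|x - y| => k1 k2 k3; nra.
have L20 : 0 <= 2 * L by rewrite mulr_ge0// ltW.
have qPhi s : 0 <= s -> q s = Phi eps s (P u0).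
  by apply: (reduced_flow_unique hip lA hnn hP domP L20 G_lip solq' solPhi); rewrite q0 Phi0.
have up s : 0 <= s -> `|u s - p s| <= expR (- (Lam * s)) * C + M / Lam.
  move=> s0; have [T hT hmild] := hS; have [_ mild] := hmild u0.
  have := mild_decay hip dA symA hnn hT hM hFM mild hQ rQ Lam0 lowQ s0.
  move=> /le_trans; apply; rewrite lerD2r ler_wpM2l ?expR_ge0//.
  exact: BC.
have monopq s : tstar <= s -> sigma * `|p s - q s| ^+ 2 <=
    ip (A (p s - q s) - P (F (p s + hq (p s)) - F (q s + hq (q s)))) (p s - q s).
  move=> ts; have [Vp Vq] := absV _ _ Bu0 ts.
  by apply: monoV => //; rewrite qPhi// (le_trans htstar).
have pq0 : p 0 = q 0 by rewrite q0 /p /u (mild_semiflow_initial hip hS).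
have := reduction_error hip lA hnn hP domP hL Lam0 hsigma C0 htstar hFL solp solq pq0
  vE hLam up monopq t0.
rewrite -/D (ip_norm hip) => err.
(* The sign of [D] is read off from the estimate just obtained, which bounds a square. *)
have D0 : 0 <= D.
  by have := le_trans (sqr_ge0 _) err; rewrite pmulr_lge0// invr_gt0 exprn_gt0.
have {}err : `|p t - q t| <= Num.sqrt D / Lam.
  have sL : 0 <= Num.sqrt D / Lam by rewrite divr_ge0 ?sqrtr_ge0// ltW.
  rewrite -(ler_pXn2r (n := 2)) ?nnegrE//.
  by rewrite expr_div_n sqr_sqrtr.
rewrite -/(v t) (vE t t0) /Rmap -/(u t) -/(p t).
have Pp : P (p t) = p t by exact: (projK hP).
have Pq : P (q t) = q t by exact: (projK hP).
have := hhalf _ _ Pp Pq; have := ler_normD (p t - q t) (hq (p t) - hq (q t)).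
rewrite opprD addrACA => l1 l2.
have -> : 2 * (Num.sqrt D / mu) * eps ^+ 2 = 2 * (Num.sqrt D / Lam).
  by rewrite /Lam; field; rewrite !gt_eqF.
by have := normr_ge0 (p t - q t); lra.
Unshelve. all: end_near. Qed.
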